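(* Let $\gamma>1$ be fixed and let $(G_n)_{n\ge 1}$ be the superlinear preferential attachment tree process with weight $w(d)=d^\gamma$ (defined in the context). Then the following hold. (1) For integers $k$: (a) If $1\le k<\frac{\gamma}{\gamma-1}$, then $$\lim_{n\to\infty}\frac{1}{n^{k-(k-1)\gamma}}Z_k(n)=a_k\quad\text{a.s.}$$ (b) If $k=\frac{\gamma}{\gamma-1}\ge 2$ is an integer, then $$\lim_{n\to\infty}\frac{1}{\log(n)}Z_k(n)=b_k\quad\text{a.s.}$$ (c) If $k>\frac{\gamma}{\gamma-1}$, then $$\lim_{n\to\infty}\Phi_k(n)<\infty\quad\text{a.s.}$$ (2) Almost surely there are a finite random time $n_0$ and a random vertex $v$ such that for all $n\ge n_0$ the maximum degree $V(n)$ is achieved at $v$; moreover $$\lim_{n\to\infty}\frac1n V(n)=1\quad\text{a.s.},$$ and a.s. all vertices other than $v$ in the process $(G_n)$ have bounded degree, i.e. there is a finite random constant bounding the degree in $G_n$, for all $n$, of every vertex other than $v$.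
   Context: Model. Let $w:\mathbb N\to\mathbb R_+$, $w(d)=d^\gamma$. At time $n=1$ the graph $G_1$ consists of two vertices joined by a single edge. At each time $n\ge2$, given $G_1,\dots,G_{n-1}$, a new vertex is added and joined by one edge to a vertex $x$ of $G_{n-1}$ chosen with probability $w(d_x(n-1))/\sum_{y\in G_{n-1}}w(d_y(n-1))$, where $d_z(j)$ is the degree of vertex $z$ in $G_j$. The resulting graph is $G_n$ (a random tree with $n+1$ vertices and $n$ edges). Notation. $Z_k(n)$ is the number of vertices of degree $k$ in $G_n$; $\Phi_k(n)=\sum_{\ell\ge k}Z_\ell(n)$ is the number of vertices of degree at least $k$ in $G_n$ (nondecreasing in $n$); $V(n)=\max\{k: Z_k(n)\ge1\}$ is the largest degree in $G_n$. Constants: $$a_k=\prod_{j=2}^k\frac{w(j-1)}{j-(j-1)\gamma}\quad(a_1=1),\qquad b_k=w(k-1)\,a_{k-1}.$$ *)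

(* Defs.v *)
From HB Require Import structures.
From mathcomp Require Import all_boot all_order all_algebra.
From mathcomp Require Import all_classical all_reals all_analysis.
Set Implicit Arguments.
Unset Strict Implicit.
Unset Printing Implicit Defensive.
Import Order.TTheory GRing.Theory Num.Theory.
Import numFieldNormedType.Exports.
Local Open Scope classical_set_scope.
Local Open Scope ring_scope.

(* A labelled graph [(m, E)]: the vertices are the natural numbers [x < m],
   listed in order of arrival, and [E] lists the edges, each once, by their two
   endpoints. *)
Definition graph : Type := (nat * seq (nat * nat))%type.
Definition nvertices (g : graph) : nat := g.1.
Definition edges (g : graph) : seq (nat * nat) := g.2.

Definition deg (g : graph) (x : nat) : nat :=
  count (fun e : nat * nat => (e.1 == x) || (e.2 == x)) (edges g).

Definition single_edge : graph := (2%N, [:: (0%N, 1%N)]).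

(* The new vertex is labelled by the current number of vertices. *)
Definition attach (g : graph) (x : nat) : graph :=
  ((nvertices g).+1, (x, nvertices g) :: edges g).

Definition Zdeg (k : nat) (g : graph) : nat :=
  #|[set x : 'I_(nvertices g) | deg g x == k]%SET|.

(* In the next two definitions the range of degrees is truncated at the number
   of edges, which no degree exceeds (see [deg_le]). *)
Definition Phi (k : nat) (g : graph) : nat :=
  (\sum_(k <= l < (size (edges g)).+1) Zdeg l g)%N.

Definition Vmax (g : graph) : nat :=
  (\max_(k < (size (edges g)).+1 | (1 <= Zdeg k g)%N) k)%N.

Lemma deg_le (g : graph) (x : nat) : (deg g x <= size (edges g))%N.
Proof. exact: count_size. Qed.

(* [G n] is the graph at time [n >= 1]; [G 0] is unconstrained.  Since only
   countably many graphs exist, the law of the new edge given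
   [G 1, ..., G n.-1] is specified on each atom [G 1 = h 1, ...,
   G n.-1 = h n.-1] of the past, in product form (both sides vanish on null
   atoms). *)
Record preferential_attachment d (T : measurableType d) (R : realType)
    (P : probability T R) (w : nat -> R) (G : nat -> T -> graph) : Prop :=
  PreferentialAttachment {
  pa_measurable : forall (n : nat) (g : graph), (1 <= n)%N ->
    measurable [set t | G n t = g];
  pa_init : forall t, G 1%N t = single_edge;
  pa_step : forall (n : nat) (t : T), (2 <= n)%N ->
    exists2 x : nat, (x < nvertices (G n.-1 t))%N &
      G n t = attach (G n.-1 t) x;
  pa_law : forall (n : nat) (h : nat -> graph) (x : nat), (2 <= n)%N ->
    (x < nvertices (h n.-1))%N ->
    P [set t | (forall i : nat, (1 <= i < n)%N -> G i t = h i) /\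
               G n t = attach (h n.-1) x] =
    (P [set t | forall i : nat, (1 <= i < n)%N -> G i t = h i] *
     (w (deg (h n.-1) x) /
      \sum_(y < nvertices (h n.-1)) w (deg (h n.-1) y))%:E)%E }.

Definition weight (R : realType) (gamma : R) (d : nat) : R := d%:R `^ gamma.

Definition a_ (R : realType) (gamma : R) (k : nat) : R :=
  \prod_(2 <= j < k.+1)
    (weight gamma j.-1 / (j%:R - (j%:R - 1) * gamma)).

Definition b_ (R : realType) (gamma : R) (k : nat) : R :=
  weight gamma k.-1 * a_ gamma k.-1.

(* Main.v *)
Require Import Defs.
From HB Require Import structures.
From mathcomp Require Import all_boot all_order all_algebra.
From mathcomp Require Import all_classical all_reals all_analysis.
From mathcomp Require Import zify ring lra.
Set Implicit Arguments.
Unset Strict Implicit.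
Unset Printing Implicit Defensive.
Import Order.TTheory GRing.Theory Num.Theory.
Import numFieldNormedType.Exports.
Local Open Scope classical_set_scope.
Local Open Scope ring_scope.

(** The process is a Markov chain on growing trees, and a tree records its own
    past, so that every conditional expectation is a finite sum over the possible
    targets of the next edge ([target_prob], [next_mean]).  Three tools reduce the
    almost sure statements to one-step inequalities.  A nonnegative
    supermartingale is almost surely bounded ([supermartingale_bounded], from
    Ville's maximal inequality).  A counting process follows the sum of its
    conditional jump probabilities ([count_tracks], from exponential
    supermartingales).  An event whose conditional probability given the present
    is bounded away from one at all times is negligible ([zero_one]).

    A hub emerges for three reasons.  The inverse of the maximal degree decreases
    on average at least like [n `^ (- 1 / 4)] ([Vmax_growth]).  A young vertex
    facing a vertex of degree [D] climbs to degree [k] with probability at most of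
    order [D `^ (- (gamma - 1) * (k - 1))], so that for large [k] finitely many
    vertices ever have degree at least [k] ([Phi_bounded_ae]).  Finally, two given
    vertices cannot both have unbounded degree ([at_most_one_unbounded]): the
    difference of their clocks, the sum of [1 / w l] over the degrees [l] passed,
    is a martingale which would have to tend to zero, and a second-moment bound
    excludes this.

    These facts hold on almost every trajectory ([typical_ae]), and the rest is
    deterministic.  The total weight is at most of order [n] plus the weight of the
    maximal degree, which improves the growth exponent of the maximal degree by
    the factor [gamma] as long as it is below one ([growth_bootstrap]), so that the
    maximal degree grows linearly ([Vmax_linear]).  Hence there is exactly one
    vertex of unbounded degree, all other degrees are bounded together
    ([hub_others]), the hub attracts almost all edges ([hit_Vmax_cvg1]) and the
    total weight is equivalent to [n `^ gamma] ([total_weight_equiv]).  The number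
    of vertices of degree at least [k + 1] then grows with intensity equivalent to
    [w k * Zdeg k / n `^ gamma], and integrating this relation from one degree to
    the next gives the exponents and the constants, the logarithm when the
    exponent vanishes, and a bounded number beyond ([Phi_cvg], [Z_cvg_ln],
    [Phi_bounded]). *)

(** * Growing trees *)

Inductive grown : nat -> graph -> Prop :=
| grown_init : grown 1 single_edge
| grown_attach n g x :
    grown n g -> (x < nvertices g)%N -> grown n.+1 (attach g x).

Lemma grown_nvertices n g : grown n g -> nvertices g = n.+1.
Proof. by elim=> // m h x _ IH _; rewrite /nvertices /= -/(nvertices h) IH. Qed.

Lemma grown_edges n g : grown n g -> size (edges g) = n.
Proof. by elim=> // m h x _ IH _; rewrite /edges /= -/(edges h) IH. Qed.

Lemma grown_gt0 n g : grown n g -> (0 < n)%N.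
Proof. by case. Qed.

Lemma attach_inj g g' x x' : attach g x = attach g' x' -> g = g' /\ x = x'.
Proof. by case: g g' => [m E] [m' E'] [-> -> _ ->]. Qed.

Lemma deg_unborn n g x : grown n g -> (nvertices g <= x)%N -> deg g x = 0%N.
Proof.
elim=> [|m h z hg IH zlt]; first by case: x => [|[|x]].
rewrite /nvertices /= => xlt; rewrite /deg /= -/(deg h x) IH; last first.
  exact: ltnW.
rewrite addn0 !ltn_eqF//; exact: ltn_trans zlt xlt.
Qed.

Lemma deg_attach g z y : (z < nvertices g)%N ->
  deg (attach g z) y = ((y == z) + (y == nvertices g) + deg g y)%N.
Proof.
move=> zlt; rewrite /deg /= [z == y]eq_sym [nvertices g == y]eq_sym.
have [->|//] := eqVneq y z; by rewrite (ltn_eqF zlt).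
Qed.

Lemma deg_attach_old g z y : (z < nvertices g)%N -> (y < nvertices g)%N ->
  deg (attach g z) y = (deg g y + (y == z))%N.
Proof. by move=> zlt ylt; rewrite deg_attach// (ltn_eqF ylt) addn0 addnC. Qed.

Lemma deg_attach_new n g z : grown n g -> (z < nvertices g)%N ->
  deg (attach g z) (nvertices g) = 1%N.
Proof.
move=> hg zlt; rewrite deg_attach// eqxx (gtn_eqF zlt) (deg_unborn hg)//.
Qed.

Lemma deg_gt0 n g x : grown n g -> (x < nvertices g)%N -> (0 < deg g x)%N.
Proof.
move=> hg; elim: hg x => [|m h z hg IH zlt] x.
  by case: x => [|[|x]].
rewrite /nvertices /= ltnS leq_eqVlt => /orP[/eqP ->|xlt].
  by rewrite (deg_attach_new hg).
by rewrite deg_attach_old// (leq_trans (IH _ xlt))// leq_addr.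
Qed.

(** One attachment moves one vertex from degree [d] to [d + 1] and creates one
    vertex of degree [1]; every degree statistic follows from this. *)
Lemma sum_deg_attach (V : zmodType) (phi : nat -> V) n g z :
  grown n g -> (z < nvertices g)%N ->
  \sum_(x < nvertices (attach g z)) phi (deg (attach g z) x) =
  \sum_(x < nvertices g) phi (deg g x)
    + (phi (deg g z).+1 - phi (deg g z)) + phi 1%N.
Proof.
move=> hg zlt; rewrite {1}/nvertices /= -/(nvertices g) big_ord_recr /=.
rewrite (deg_attach_new hg)//; congr (_ + _).
rewrite (bigD1 (Ordinal zlt))//= [in RHS](bigD1 (Ordinal zlt))//=.
rewrite deg_attach_old// eqxx addn1 addrAC; congr (_ + _).
  by rewrite addrC subrK.
apply: eq_bigr => i iz; rewrite deg_attach_old//.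
have /negbTE -> : (i != z :> nat) by apply: contra iz => /eqP ?; apply/eqP/val_inj.
by rewrite addn0.
Qed.

Lemma ZdegE k g : Zdeg k g = (\sum_(x < nvertices g) (deg g x == k))%N.
Proof.
rewrite /Zdeg -sum1_card big_mkcond /=; apply: eq_bigr => x _.
by rewrite inE; case: eqP.
Qed.

Lemma PhiE k g : Phi k g = (\sum_(x < nvertices g) (k <= deg g x))%N.
Proof.
rewrite /Phi; under eq_bigr do rewrite ZdegE.
rewrite exchange_big /=; apply: eq_bigr => x _.
have dle := deg_le g x.
have [kd|dk] := leqP k (deg g x).
  rewrite (bigD1_seq (deg g x)) /= ?iota_uniq ?mem_index_iota ?kd ?ltnS//.
  by rewrite eqxx big1// => i /negbTE; rewrite eq_sym => ->.
rewrite big_nat_cond big1// => i /andP[/andP[ki _] _].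
by rewrite (ltn_eqF (leq_trans dk ki)).
Qed.

Lemma VmaxE g : Vmax g = (\max_(x < nvertices g) deg g x)%N.
Proof.
apply/eqP; rewrite eqn_leq; apply/andP; split; apply/bigmax_leqP => /=.
  move=> k; rewrite ZdegE lt0n sum_nat_eq0 negb_forall => /existsP[x].
  rewrite eqb0 negbK => /eqP <-; exact: (leq_bigmax x).
move=> x _; have xlt : (deg g x < (size (edges g)).+1)%N by rewrite ltnS deg_le.
apply: (@leq_bigmax_cond _ _ (fun k : 'I_(size (edges g)).+1 => k : nat) (Ordinal xlt)).
rewrite ZdegE lt0n sum_nat_eq0 negb_forall; apply/existsP; exists x.
by rewrite /= eqxx.
Qed.

Lemma deg_le_Vmax g x : (x < nvertices g)%N -> (deg g x <= Vmax g)%N.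
Proof. by move=> xlt; rewrite VmaxE; exact: (leq_bigmax (Ordinal xlt)). Qed.

Lemma Vmax_attained n g : grown n g ->
  exists2 x, (x < nvertices g)%N & deg g x = Vmax g.
Proof.
move=> hg; rewrite VmaxE.
have c : (0 < #|'I_(nvertices g)|)%N by rewrite card_ord (grown_nvertices hg).
by have [x ->] := bigop.eq_bigmax (fun x : 'I_(nvertices g) => deg g x) c; exists x.
Qed.

Lemma Vmax_gt0 n g : grown n g -> (0 < Vmax g)%N.
Proof. by move=> hg; have [x xlt <-] := Vmax_attained hg; exact: deg_gt0 hg _. Qed.

Lemma Vmax_attach n g z : grown n g -> (z < nvertices g)%N ->
  Vmax (attach g z) = maxn (Vmax g) (deg g z).+1.
Proof.
move=> hg zlt; apply/eqP; rewrite eqn_leq; apply/andP; split.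
  rewrite [X in (X <= _)%N]VmaxE; apply/bigmax_leqP => -[x xlt] _ /=.
  have [xo|xn] := ltnP x (nvertices g).
    rewrite deg_attach_old//; have [->|xz] := eqVneq x z.
      by rewrite addn1 leq_maxr.
    by rewrite addn0 leq_max deg_le_Vmax.
  have -> : x = nvertices g by move: xlt xn; rewrite {1}/nvertices /= -/(nvertices g); lia.
  by rewrite (deg_attach_new hg)// leq_max ltnS orbC.
rewrite geq_max; apply/andP; split.
  have [x xlt <-] := Vmax_attained hg.
  rewrite (leq_trans (leq_addr (x == z) _))// -deg_attach_old//.
  by apply: deg_le_Vmax; rewrite /nvertices /=; exact: ltnW.
have := @deg_le_Vmax (attach g z) z; rewrite deg_attach_old// eqxx addn1.
by apply; rewrite /nvertices /=; exact: ltnW.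
Qed.

Lemma Phi_attach k n g z : (1 < k)%N -> grown n g -> (z < nvertices g)%N ->
  Phi k (attach g z) = (Phi k g + (deg g z == k.-1))%N.
Proof.
move=> k1 hg zlt; have := @sum_deg_attach int (fun d => (k <= d)%N : int) n g z hg zlt.
have E : ((k <= (deg g z).+1)%N = (k <= deg g z)%N + (deg g z == k.-1) :> nat)%N.
  by move: (deg g z) => m; case: (ltngtP m k.-1) => ?; lia.
have -> : (k <= 1)%N = false by lia.
rewrite !PhiE -!(big_morph Posz PoszD (erefl _)) E PoszD addr0 => H.
by apply/eqP; rewrite -eqz_nat H PoszD [X in X - _]addrC addrK.
Qed.

Lemma Phi1 n g : grown n g -> Phi 1 g = n.+1.
Proof.
move=> hg; rewrite PhiE -(grown_nvertices hg) -[RHS]card_ord -sum1_card.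
by apply: eq_bigr => x _; rewrite (deg_gt0 hg).
Qed.

Lemma Zdeg_Phi k g : (Zdeg k g + Phi k.+1 g = Phi k g)%N.
Proof.
rewrite ZdegE !PhiE -big_split /=; apply: eq_bigr => x _; lia.
Qed.

Lemma sum_deg n g : grown n g -> (\sum_(x < nvertices g) deg g x = 2 * n)%N.
Proof.
elim=> [|m h z hg IH zlt]; first by rewrite !big_ord_recr big_ord0.
have := @sum_deg_attach int (fun d => d : int) m h z hg zlt.
rewrite -!(big_morph Posz PoszD (erefl _)) => H.
by apply/eqP; rewrite -eqz_nat H IH; lia.
Qed.

(** * Measurable events and real-valued probabilities *)

Section events.
Context d (T : measurableType d) (R : realType) (P : probability T R).

Lemma measurable_forall I (p : I -> T -> Prop) : countable [set: I] ->
  (forall i, measurable [set t | p i t]) -> measurable [set t | forall i, p i t].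
Proof.
move=> cI mp; have -> : [set t | forall i, p i t] =
    ~` \bigcup_i ~` [set t | p i t].
  apply/seteqP; split=> t /=; first by move=> h [i _]; apply; exact: h.
  by move=> h i; apply/not_notP => npi; apply: h; exists i.
apply: measurableC; apply: countable_bigcupT_measurable => // i.
exact: measurableC.
Qed.

Lemma measurable_exists I (p : I -> T -> Prop) : countable [set: I] ->
  (forall i, measurable [set t | p i t]) -> measurable [set t | exists i, p i t].
Proof.
move=> cI mp; have -> : [set t | exists i, p i t] = \bigcup_i [set t | p i t].
  by apply/seteqP; split=> t /= [i]; [exists i|exists i].
exact: countable_bigcupT_measurable.
Qed.

Lemma measurable_imply (p q : T -> Prop) : measurable [set t | p t] ->
  measurable [set t | q t] -> measurable [set t | p t -> q t].
Proof.
move=> mp mq; have -> : [set t | p t -> q t] = ~` [set t | p t] `|` [set t | q t].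
  apply/seteqP; split=> t /=; last by case.
  by move=> h; have [pt|pt] := pselect (p t); [right; exact: h|left].
by apply: measurableU => //; exact: measurableC.
Qed.

Lemma measurable_conj (p q : T -> Prop) : measurable [set t | p t] ->
  measurable [set t | q t] -> measurable [set t | p t /\ q t].
Proof. exact: measurableI. Qed.

Lemma measurable_const (p : Prop) : measurable [set t : T | p].
Proof.
have [pt|np] := pselect p.
  by rewrite (_ : [set _ | _] = setT)//; apply/seteqP; split.
by rewrite (_ : [set _ | _] = set0)//; apply/seteqP; split.
Qed.

Definition prob (A : set T) : R := fine (P A).

Lemma probE A : measurable A -> P A = (prob A)%:E.
Proof. by move=> mA; rewrite /prob fineK// fin_num_measure. Qed.

Lemma prob_ge0 A : 0 <= prob A.
Proof. by rewrite /prob fine_ge0. Qed.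

Lemma le_prob A B : measurable A -> measurable B -> A `<=` B -> prob A <= prob B.
Proof. by move=> mA mB AB; rewrite -lee_fin -!probE// le_measure ?inE. Qed.

Lemma prob_setD A B : measurable A -> measurable B ->
  prob A = prob (A `&` B) + prob (A `&` ~` B).
Proof.
move=> mA mB; have mBc := measurableC mB; apply: EFin_inj; rewrite EFinD.
rewrite -!probE//; try exact: measurableI.
rewrite -measureU; [|exact: measurableI|exact: measurableI|].
  by rewrite -setIUr setUv setIT.
by rewrite setIACA setICr setI0.
Qed.

Lemma prob_bigcup_ord n (F : 'I_n -> set T) : (forall i, measurable (F i)) ->
  trivIset setT F -> prob (\bigcup_i F i) = \sum_(i < n) prob (F i).
Proof.
move=> mF tF; apply: EFin_inj; rewrite -probE; last first.
  by apply: countable_bigcupT_measurable.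
have -> : \bigcup_i F i = \big[setU/set0]_(i < n) F i.
  apply/seteqP; split=> t; first by move=> [i _ Fit]; rewrite (bigD1 i)//; left.
  by elim/big_ind : _ => // [A B hA hB [/hA|/hB]//|i _ Fit]; exists i.
rewrite (@measure_bigsetU_ord _ _ _ P n predT)// -sumEFin.
by apply: eq_bigr => i _; exact: probE.
Qed.

Lemma prob_bigcup_le (F : (set T)^nat) c : (forall n, measurable (F n)) ->
  nondecreasing_seq F -> (forall n, prob (F n) <= c) -> prob (\bigcup_n F n) <= c.
Proof.
move=> mF ndF Fc; have mU : measurable (\bigcup_n F n).
  exact: bigcupT_measurable.
rewrite -lee_fin -probE//.
have cv := nondecreasing_cvg_mu (mu := P) mF mU ndF.
rewrite -(cvg_lim _ cv)//; apply: lime_le; first by apply/cvg_ex; eexists; exact: cv.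
by apply: nearW => n /=; rewrite probE// lee_fin.
Qed.

Lemma prob_bigcap_ge (F : (set T)^nat) c : (forall n, measurable (F n)) ->
  nonincreasing_seq F -> (forall n, c <= prob (F n)) -> c <= prob (\bigcap_n F n).
Proof.
move=> mF niF Fc; have mI : measurable (\bigcap_n F n).
  exact: bigcapT_measurable.
rewrite -lee_fin -probE//.
have fin : (P (F 0%N) < +oo)%E by rewrite probE// ltry.
have cv := nonincreasing_cvg_mu (mu := P) fin mF mI niF.
rewrite -(cvg_lim _ cv)//; apply: lime_ge; first by apply/cvg_ex; eexists; exact: cv.
by apply: nearW => n /=; rewrite probE// lee_fin.
Qed.

Lemma ae_prob0 (p : T -> Prop) : measurable [set t | ~ p t] ->
  prob [set t | ~ p t] <= 0 -> {ae P, forall t, p t}.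
Proof.
move=> mp p0; exists [set t | ~ p t]; split => //.
by apply/eqP; rewrite probE// eqe eq_le p0 prob_ge0.
Qed.

End events.

(** * The process as a Markov chain on trees *)

Section chain.
Context d (T : measurableType d) (R : realType) (P : probability T R).
Variables (w : nat -> R) (G : nat -> T -> graph).
Hypothesis w_gt0 : forall k, (0 < k)%N -> 0 < w k.
Hypothesis hG : preferential_attachment P w G.

Definition total_weight (g : graph) : R := \sum_(y < nvertices g) w (deg g y).

Definition target_prob (g : graph) (x : nat) : R := w (deg g x) / total_weight g.

Definition next_mean (F : graph -> R) (g : graph) : R :=
  \sum_(x < nvertices g) target_prob g x * F (attach g x).

Lemma weight_le_total n g x : grown n g -> (x < nvertices g)%N ->
  w (deg g x) <= total_weight g.
Proof.
move=> hg xlt; rewrite /total_weight (bigD1 (Ordinal xlt))//= lerDl.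
by apply: sumr_ge0 => i _; rewrite ltW// w_gt0//; exact: deg_gt0 hg _.
Qed.

Lemma total_weight_gt0 n g : grown n g -> 0 < total_weight g.
Proof.
move=> hg; have xlt : (0 < nvertices g)%N by rewrite (grown_nvertices hg).
by apply: lt_le_trans (weight_le_total hg xlt); rewrite w_gt0//; exact: deg_gt0 hg _.
Qed.

Lemma target_prob_ge0 n g x : grown n g -> (x < nvertices g)%N -> 0 <= target_prob g x.
Proof.
move=> hg xlt; rewrite divr_ge0// ltW ?(total_weight_gt0 hg)// w_gt0//.
exact: deg_gt0 hg _.
Qed.

Lemma sum_target_prob n g : grown n g -> \sum_(x < nvertices g) target_prob g x = 1.
Proof.
move=> hg; rewrite -mulr_suml divff// gt_eqF//; exact: total_weight_gt0 hg.
Qed.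

Lemma G_grown n t : (0 < n)%N -> grown n (G n t).
Proof.
case: n => // n _; elim: n => [|n IH].
  by rewrite (pa_init hG); exact: grown_init.
have [x xlt ->] := pa_step hG t (isT : (2 <= n.+2)%N); exact: grown_attach.
Qed.

Lemma G_step n t : (0 < n)%N ->
  exists2 x, (x < nvertices (G n t))%N & G n.+1 t = attach (G n t) x.
Proof. by case: n => // n _; exact: (pa_step hG t (isT : (2 <= n.+2)%N)). Qed.

Lemma measurable_G n (Q : graph -> Prop) : (0 < n)%N -> measurable [set t | Q (G n t)].
Proof.
move=> n0; rewrite (_ : [set t | Q (G n t)] =
  [set t | exists g : graph, Q g /\ G n t = g]); last first.
  by apply/seteqP; split=> t /= => [q|[g [q ->]]//]; exists (G n t).
apply: measurable_exists => [|g]; first exact: countableP.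
apply: measurable_conj; [exact: measurable_const|exact: (pa_measurable hG)].
Qed.

(** The edges are listed in order of arrival, so a tree remembers its own growth:
    conditioning on the whole past is conditioning on the current tree. *)
Lemma G_past n t t' : (0 < n)%N -> G n t = G n t' ->
  forall i, (0 < i <= n)%N -> G i t = G i t'.
Proof.
case: n => // n _; elim: n => [|n IH] Gtt' i.
  by rewrite -eqn_leq => /eqP <-.
rewrite [(i <= _)%N]leq_eqVlt => /andP[i0 /orP[/eqP ->//|ilt]].
apply: IH; last by rewrite i0 -ltnS.
have [x _ tx] := @G_step n.+1 t isT; have [x' _ tx'] := @G_step n.+1 t' isT.
by move: Gtt'; rewrite tx tx' => /attach_inj[].
Qed.

Lemma prob_attach n g x : grown n g -> (x < nvertices g)%N ->
  prob P [set t | G n.+1 t = attach g x] =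
  prob P [set t | G n t = g] * target_prob g x.
Proof.
move=> hg xlt; have n0 := grown_gt0 hg.
have [[t0 t0g]|nog] := pselect (exists t, G n t = g); last first.
  have -> : [set t | G n t = g] = set0.
    by apply/seteqP; split=> t //= tg; apply: nog; exists t.
  have -> : [set t | G n.+1 t = attach g x] = set0.
    apply/seteqP; split=> t //= tg; apply: nog; exists t.
    by have [y _] := G_step t n0; rewrite tg => /attach_inj[].
  by rewrite /prob measure0 mul0r.
have := @pa_law _ _ _ _ _ _ hG n.+1 (fun i => G i t0) x.
rewrite /= t0g ltnS => /(_ n0 xlt).
have -> : [set t | forall i, (1 <= i < n.+1)%N -> G i t = G i t0] =
    [set t | G n t = g].
  apply/seteqP; split=> t /=; first by move=> /(_ n); rewrite n0 ltnSn t0g; exact.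
  by rewrite -t0g => tt0 i; rewrite ltnS; exact: G_past tt0 i.
have -> : [set t | (forall i, (1 <= i < n.+1)%N -> G i t = G i t0) /\
    G n.+1 t = attach g x] = [set t | G n.+1 t = attach g x].
  apply/seteqP; split=> t /= => [[]//|tg]; split => // i.
  rewrite ltnS; apply: G_past => //; rewrite t0g.
  by have [y _] := G_step t n0; rewrite tg => /attach_inj[].
rewrite !probE ?measurable_G//; try exact: (pa_measurable hG).
by rewrite -EFinM; exact: EFin_inj.
Qed.

(** Partition according to the target of the next edge: the inductions on the
    horizon below all rest on this identity. *)
Lemma prob_split n g (E : set T) : grown n g -> measurable E ->
  prob P ([set t | G n t = g] `&` E) =
  \sum_(x < nvertices g) prob P ([set t | G n.+1 t = attach g x] `&` E).
Proof.
move=> hg mE; have n0 := grown_gt0 hg.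
rewrite -prob_bigcup_ord => [|x|].
- congr prob; rewrite -setI_bigcupl; congr (_ `&` _).
  apply/seteqP; split=> t /=.
    move=> tg; have [x] := G_step t n0; rewrite tg => xlt tx.
    by exists (Ordinal xlt).
  by move=> [x _ /= tx]; have [y _] := G_step t n0; rewrite tx => /attach_inj[].
- by apply: measurableI => //; exact: (pa_measurable hG).
- move=> x y _ _ [t /= [[tx _] [ty _]]]; apply: val_inj => /=.
  by move: tx; rewrite ty => /attach_inj[].
Qed.

Lemma prob_next n g : grown n g -> prob P [set t | G n t = g] =
  \sum_(x < nvertices g) prob P [set t | G n.+1 t = attach g x].
Proof.
move=> hg; rewrite -[in LHS](setIT [set t | G n t = g]) prob_split//.
by apply: eq_bigr => x _; rewrite setIT.
Qed.

Lemma prob_next_mean n g F : grown n g ->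
  \sum_(x < nvertices g) prob P [set t | G n.+1 t = attach g x] * F (attach g x) =
  prob P [set t | G n t = g] * next_mean F g.
Proof.
move=> hg; rewrite mulr_sumr; apply: eq_bigr => x _.
by rewrite prob_attach// mulrA.
Qed.

(** The tree at time [n] takes countably many values, so an event that it decides
    is measurable, even an event that speaks of the whole past. *)
Lemma measurable_adapted n (p : T -> Prop) : (0 < n)%N ->
  (forall t t', G n t = G n t' -> p t -> p t') -> measurable [set t | p t].
Proof.
move=> n0 ap; rewrite (_ : [set t | p t] =
  [set t | exists t', G n t' = G n t /\ p t']).
  exact: (@measurable_G n (fun g => exists t', G n t' = g /\ p t')).
apply/seteqP; split=> t /= => [pt|[t' [+ pt']]]; first by exists t.
by move=> /ap; apply.
Qed.

Lemma ville_measurable (F rho : graph -> R) K n m : (0 < n)%N ->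
  measurable [set t | exists i, (n <= i <= n + m)%N /\
    K * \prod_(n <= j < i) rho (G j t) <= F (G i t)].
Proof.
move=> n0; apply: measurable_exists => [|i]; first exact: countableP.
have [/andP[ni im]|out] := boolP (n <= i <= n + m)%N; last first.
  by rewrite (_ : [set t | _] = set0)//; apply/seteqP; split=> t //= [].
have i0 : (0 < i)%N by exact: leq_trans ni.
apply: (@measurable_adapted i) => // t t' tt' [_ h]; split=> //.
rewrite -tt' (eq_big_nat _ _ (F2 := fun j => rho (G j t)))// => j /andP[nj ji].
by congr rho; apply/esym/(G_past i0 tt'); rewrite (leq_trans n0 nj) ltnW.
Qed.

(** Ville's maximal inequality, for a supermartingale normalised by the product
    of its predictable growth factors [rho]: seen from the next tree, the level
    to reach is [K * rho g], which makes an induction on the horizon work. *)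
Lemma ville_atom (F rho : graph -> R) :
  (forall n g, grown n g -> 0 <= F g) ->
  (forall n g, grown n g -> 0 < rho g) ->
  (forall n g, grown n g -> next_mean F g <= rho g * F g) ->
  forall m n g K, grown n g -> 0 < K ->
  prob P ([set t | G n t = g] `&` [set t | exists i, (n <= i <= n + m)%N /\
    K * \prod_(n <= j < i) rho (G j t) <= F (G i t)]) * K <=
  prob P [set t | G n t = g] * F g.
Proof.
move=> F0 rho0 Frho; elim=> [|m IH] n g K hg K0; have n0 := grown_gt0 hg;
  have mg : measurable [set t | G n t = g] by exact: (pa_measurable hG).
- have [KF|FK] := leP K (F g).
    apply: ler_pM => //; [exact: prob_ge0|exact: ltW|].
    by apply: le_prob => //; apply: measurableI => //; exact: ville_measurable.
  rewrite (_ : _ `&` _ = set0) ?/prob ?measure0 ?mul0r ?mulr_ge0 ?prob_ge0 ?(F0 _ _ hg)//.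
  apply/seteqP; split=> t //= [tg [i []]]; rewrite addn0 -eqn_leq => /eqP <-.
  by rewrite big_geq// mulr1 tg leNgt FK.
- have [KF|FK] := leP K (F g).
    apply: ler_pM => //; [exact: prob_ge0|exact: ltW|].
    by apply: le_prob => //; apply: measurableI => //; exact: ville_measurable.
  have Kr0 : 0 < K * rho g by rewrite mulr_gt0// (rho0 _ _ hg).
  have -> : [set t | G n t = g] `&` [set t | exists i, (n <= i <= n + m.+1)%N /\
      K * \prod_(n <= j < i) rho (G j t) <= F (G i t)] =
    [set t | G n t = g] `&` [set t | exists i, (n.+1 <= i <= n.+1 + m)%N /\
      K * rho g * \prod_(n.+1 <= j < i) rho (G j t) <= F (G i t)].
    apply/seteqP; split=> t /= [tg [i [/andP[ni im] H]]]; split=> //; exists i.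
      move: ni; rewrite leq_eqVlt => /orP[/eqP ni|ni].
        by move: H; rewrite -ni big_geq// mulr1 tg leNgt FK.
      by move: H; rewrite big_ltn// tg mulrA addSnnS ni im.
    by move: H; rewrite -tg -mulrA -big_ltn// (ltnW ni) -addSnnS im.
  rewrite prob_split//; last exact: ville_measurable.
  rewrite -(ler_pM2r (rho0 _ _ hg)) -mulrA mulr_suml.
  apply: (@le_trans _ _ (\sum_(x < nvertices g)
      prob P [set t | G n.+1 t = attach g x] * F (attach g x))).
    by apply: ler_sum => x _; apply: IH => //; exact: grown_attach.
  by rewrite prob_next_mean// -mulrA ler_wpM2l ?prob_ge0// [X in _ <= X]mulrC; exact: Frho hg.
Qed.

(** By the maximal inequality the level [K.+1] is reached with probability at most
    [F single_edge / K.+1], which tends to zero. *)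
Lemma supermartingale_bounded (F rho : graph -> R) :
  (forall n g, grown n g -> 0 <= F g) ->
  (forall n g, grown n g -> 0 < rho g) ->
  (forall n g, grown n g -> next_mean F g <= rho g * F g) ->
  {ae P, forall t, exists2 K, 0 < K &
    forall n, (0 < n)%N -> F (G n t) <= K * \prod_(1 <= j < n) rho (G j t)}.
Proof.
move=> F0 rho0 Frho.
pose E K m := [set t | exists i, (1 <= i <= 1 + m)%N /\
  K.+1%:R * \prod_(1 <= j < i) rho (G j t) <= F (G i t)].
have mE K m : measurable (E K m) by exact: ville_measurable.
have mU K : measurable (\bigcup_m E K m) by exact: bigcupT_measurable.
have EK K : prob P (\bigcup_m E K m) <= F single_edge / K.+1%:R.
  apply: prob_bigcup_le => //.
    move=> m1 m2 m12; apply/subsetPset => t [i [/andP[i1 im] h]]; exists i; split=> //.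
    by rewrite i1/= (leq_trans im)// leq_add2l.
  move=> m; rewrite ler_pdivlMr//.
  have := @ville_atom F rho F0 rho0 Frho m 1 single_edge K.+1%:R grown_init (ltr0Sn _ _).
  rewrite (_ : [set t | G 1 t = _] = setT) ?setTI; last first.
    by apply/seteqP; split=> // t _; exact: pa_init hG t.
  by rewrite [prob P setT]/prob probability_setT mul1r.
have mI : measurable (\bigcap_K \bigcup_m E K m) by exact: bigcapT_measurable.
exists (\bigcap_K \bigcup_m E K m); split=> //.
  rewrite probE//; congr EFin; apply/eqP; rewrite eq_le prob_ge0 andbT.
  rewrite leNgt; apply/negP => p0.
  set p := prob _ _ in p0.
  have := EK (Num.truncn (F single_edge / p)).
  apply/negP; rewrite -ltNge; apply: (@lt_le_trans _ _ p); last first.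
    by apply: le_prob => // t; exact.
  by rewrite ltr_pdivrMr// mulrC -ltr_pdivrMr// truncnS_gt.
move=> t /= nb K _; apply: contrapT => nE; apply: nb.
exists K.+1%:R => // n n0; rewrite leNgt; apply/negP => lt; apply: nE.
by exists n.-1 => //; exists n; rewrite add1n prednK// n0 leqnn; split=> //; exact: ltW.
Qed.

(** A submartingale [F] with values at most [a], except for an excess [b] on the
    event that [Q] fails, forces this event to be likely.  The invariant [I]
    restricts the trees on which [F] needs to be a submartingale. *)
Lemma submartingale_escape (I Q : graph -> Prop) (F : graph -> R) (a b : R) :
  (forall n g x, grown n g -> (x < nvertices g)%N -> I g -> I (attach g x)) ->
  (forall n g, grown n g -> I g -> F g <= next_mean F g) ->
  (forall n g, grown n g -> I g -> F g <= a + b) ->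
  (forall n g, grown n g -> I g -> Q g -> F g <= a) ->
  0 <= b ->
  forall m n g, grown n g -> I g ->
  prob P [set t | G n t = g] * F g <= a * prob P [set t | G n t = g] +
    b * prob P ([set t | G n t = g] `&` [set t | ~ Q (G (n + m) t)]).
Proof.
move=> Iattach subF Fab Fa b0; elim=> [|m IH] n g hg Ig; have n0 := grown_gt0 hg.
  rewrite addn0; have [Qg|nQ] := pselect (Q g).
    rewrite mulrC (le_trans (ler_wpM2r (prob_ge0 _ _) (Fa _ _ hg Ig Qg)))//.
    by rewrite lerDl mulr_ge0// prob_ge0.
  have -> : [set t | G n t = g] `&` [set t | ~ Q (G n t)] = [set t | G n t = g].
    by apply/seteqP; split=> t /= => [[]//|->].
  by rewrite -mulrDl mulrC ler_wpM2r ?prob_ge0//; exact: Fab hg Ig.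
have mQ : measurable [set t | ~ Q (G (n + m.+1) t)].
  by apply: (@measurable_G _ (fun g => ~ Q g)); rewrite addnS.
rewrite prob_split// {2}prob_next// !mulr_sumr -big_split/=.
apply: (@le_trans _ _ (\sum_(x < nvertices g)
    prob P [set t | G n.+1 t = attach g x] * F (attach g x))).
  by rewrite prob_next_mean// ler_wpM2l ?prob_ge0//; exact: subF hg Ig.
apply: ler_sum => x _; rewrite -addSnnS; apply: IH; first exact: grown_attach.
exact: Iattach hg _ Ig.
Qed.

(** Backward induction on the time left before [n] adds up the bounds available
    on the atoms of time [n]. *)
Lemma prob_cond_le (E : set T) (Q : graph -> Prop) (c : R) n : (0 < n)%N ->
  measurable E ->
  (forall g, grown n g -> Q g ->
    prob P ([set t | G n t = g] `&` E) <= c * prob P [set t | G n t = g]) ->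
  prob P ([set t | Q (G n t)] `&` E) <= c * prob P [set t | Q (G n t)].
Proof.
move=> n0 mE Ec.
suff H m : (m < n)%N -> forall g, grown (n - m) g ->
    prob P ([set t | G (n - m) t = g] `&` ([set t | Q (G n t)] `&` E)) <=
    c * prob P ([set t | G (n - m) t = g] `&` [set t | Q (G n t)]).
  have := H n.-1; rewrite prednK// leqnn => /(_ isT single_edge).
  have -> : (n - n.-1 = 1)%N by lia.
  rewrite (_ : [set t | G 1 t = _] = setT) ?setTI.
    by apply; exact: grown_init.
  by apply/seteqP; split=> // t _; exact: pa_init hG t.
have mQ : measurable [set t | Q (G n t)] by exact: measurable_G.
elim: m => [_|m IH mn] g; rewrite ?subn0 => hg.
  have [Qg|nQ] := pselect (Q g).
    have Qs : [set t | G n t = g] `&` [set t | Q (G n t)] = [set t | G n t = g].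
      by apply/seteqP; split=> t /= => [[]//|->].
    by rewrite setIA Qs; exact: Ec.
  have Qs : [set t | G n t = g] `&` [set t | Q (G n t)] = set0.
    by apply/seteqP; split=> t //= [->].
  by rewrite setIA Qs set0I /prob measure0 mulr0.
rewrite !prob_split// ?mulr_sumr; last exact: measurableI.
have -> : (n - m.+1).+1 = (n - m)%N by lia.
apply: ler_sum => x _; apply: IH; first exact: ltnW.
have -> : (n - m = (n - m.+1).+1)%N by lia.
exact: grown_attach.
Qed.

(** A zero-one law for the event that the tree reaches every level of the nested
    properties [Q N]: were its probability positive, the conditional probability
    given a late tree would come close to one. *)
Lemma zero_one (Q : nat -> graph -> Prop) (c : R) : 0 <= c -> c < 1 ->
  (forall N n g x, grown n g -> (x < nvertices g)%N -> Q N g -> Q N (attach g x)) ->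
  (forall N g, Q N.+1 g -> Q N g) ->
  (forall n g, grown n g -> Q 0%N g ->
    prob P ([set t | G n t = g] `&`
      [set t | forall N, exists2 n, (0 < n)%N & Q N (G n t)]) <=
    c * prob P [set t | G n t = g]) ->
  {ae P, forall t, ~ forall N, exists2 n, (0 < n)%N & Q N (G n t)}.
Proof.
move=> c0 c1 Qattach Qdec Ec.
set A := [set t | _] in Ec.
have Q0 N g : Q N g -> Q 0%N g by elim: N => // N IH /Qdec.
pose B N n := [set t | Q N (G n.+1 t)].
have mB N n : measurable (B N n) by exact: measurable_G.
have mU N : measurable (\bigcup_n B N n) by exact: bigcupT_measurable.
have AE : A = \bigcap_N \bigcup_n B N n.
  apply/seteqP; split=> t /= h N.
    by move=> _; have [[|n] // _ Qn] := h N; exists n.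
  by have [n _ Qn] := h N I; exists n.+1.
have mA : measurable A by rewrite AE; exact: bigcapT_measurable.
have ndB N : nondecreasing_seq (B N).
  apply/nondecreasing_seqP => n; apply/subsetPset => t /=; rewrite /B /= => Qn.
  have [x xlt ->] := @G_step n.+1 t isT; apply: Qattach xlt Qn.
  exact: (@G_grown n.+1 t).
have AB N : prob P A <= c * prob P (\bigcup_n B N n).
  have -> : A = \bigcup_n (B N n `&` A).
    rewrite -setI_bigcupl; apply/esym/setIidPr; rewrite AE => t; exact.
  apply: prob_bigcup_le => [n|n1 n2 n12|n]; first exact: measurableI.
    by apply/subsetPset; apply: setSI; apply/subsetPset; exact: ndB.
  have := @prob_cond_le A (Q N) c n.+1 isT mA (fun g hg h => Ec _ g hg (Q0 _ _ h)).
  move=> /le_trans; apply; rewrite ler_wpM2l//; apply: le_prob; [exact: mB|exact: mU|].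
  by move=> t Bt; exists n.
have AcA : prob P A <= c * prob P A.
  rewrite [in leRHS]AE; have [c00|cn0] := eqVneq c 0.
    by rewrite c00 mul0r (le_trans (AB 0%N))// c00 mul0r.
  have cp : 0 < c by rewrite lt_neqAle eq_sym cn0.
  rewrite mulrC -ler_pdivrMr//; apply: prob_bigcap_ge => // [|N].
    apply/nonincreasing_seqP => N; apply/subsetPset => t [n _ Qn].
    by exists n => //; exact: Qdec.
  by rewrite ler_pdivrMr// mulrC; exact: AB.
have A0 : prob P A <= 0.
  by rewrite -(pmulr_rle0 _ (_ : 0 < 1 - c)) ?subr_gt0// mulrBl mul1r subr_le0.
have nA : [set t | ~ ~ forall N, exists2 n, (0 < n)%N & Q N (G n t)] = A.
  by apply/seteqP; split=> t /= => [/contrapT|h]//; exact.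
by apply: ae_prob0; rewrite nA.
Qed.

End chain.

(** * Asymptotics of partial sums *)

Section asymptotics.
Variable R : realType.
Implicit Types (X Y q t T : nat -> R) (a e : R).

Definition psum q (n : nat) : R := \sum_(1 <= i < n) q i.

(** [X] follows [Y] with a relative error that is eventually negligible; this is
    how a counting process follows its compensator. *)
Definition tracks X Y := forall eps, 0 < eps -> exists K, forall n, (0 < n)%N ->
  `|X n - Y n| <= eps * Y n + K.

Lemma psumS q n : (0 < n)%N -> psum q n.+1 = psum q n + q n.
Proof. by move=> n0; rewrite /psum big_nat_recr. Qed.

Lemma psum1 q : psum q 1 = 0.
Proof. by rewrite /psum big_geq. Qed.

Lemma psum_telescope T n : (0 < n)%N -> psum (fun i => T i.+1 - T i) n = T n - T 1%N.
Proof. by move=> n0; rewrite /psum telescope_sumr. Qed.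

Lemma psum_ge0 q n : (forall i, (0 < i)%N -> 0 <= q i) -> 0 <= psum q n.
Proof.
by move=> q0; rewrite /psum big_nat_cond; apply: sumr_ge0 => i /andP[/andP[/q0]].
Qed.

(** Up to the constant [K], which absorbs the first terms, the sums compare like
    their terms. *)
Lemma psum_equiv q t a : (forall i, (0 < i)%N -> 0 < t i) ->
  (fun i => q i / t i) @ \oo --> a ->
  forall eps, 0 < eps -> exists K, forall n, (0 < n)%N ->
    `|psum q n - a * psum t n| <= eps * psum t n + K.
Proof.
move=> t0 qta eps eps0.
have /cvgrPdist_le /(_ _ eps0) [N _ HN] := qta.
exists (psum (fun i => `|q i - a * t i|) N.+1) => n n0.
have Ks m : psum (fun i => `|q i - a * t i|) m <=
    eps * psum t m + psum (fun i => `|q i - a * t i|) N.+1.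
  elim: m => [|m IH].
    by rewrite /psum big_geq// [X in eps * X]big_geq// mulr0 add0r psum_ge0.
  have [->|m0] := posnP m.
    by rewrite !psum1 mulr0 add0r psum_ge0.
  have [Nm|mN] := leqP N m.
    rewrite !(psumS _ m0) mulrDr addrAC lerD//.
    have -> : q m - a * t m = (q m / t m - a) * t m.
      by rewrite mulrBl divfK// gt_eqF// t0.
    rewrite normrM (gtr0_norm (t0 _ m0)) ler_wpM2r ?(ltW (t0 _ _))// distrC.
    exact: HN Nm.
  have /subnKC <- : (m.+1 <= N.+1)%N by exact: ltnW.
  apply: ler_wpDl.
    by rewrite mulr_ge0 ?(ltW eps0)// psum_ge0// => i /t0/ltW.
  rewrite /psum [leRHS](@big_cat_nat _ _ _ m.+1)//= ?leq_addr// lerDl.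
  exact: sumr_ge0.
apply: le_trans (Ks n); rewrite /psum mulr_sumr -sumrB.
exact: ler_norm_sum.
Qed.

Lemma tracks_equiv X q T a : tracks X (psum q) ->
  (forall i, (0 < i)%N -> T i < T i.+1) ->
  (fun i => q i / (T i.+1 - T i)) @ \oo --> a ->
  forall eps, 0 < eps -> exists K, forall n, (0 < n)%N ->
    `|X n - a * T n| <= eps * T n + K.
Proof.
move=> Xq Tinc qTa eps eps0.
have a20 : 0 < `|a| + 2 by rewrite ltr_wpDl.
(* Small enough for the errors of both comparisons to add up to [eps]. *)
pose eta := Num.min 1 (eps / (`|a| + 2)).
have eta0 : 0 < eta by rewrite lt_min ltr01 divr_gt0.
have eta1 : eta <= 1 by rewrite ge_min lexx.
have etae : eta * (`|a| + 2) <= eps by rewrite -ler_pdivlMr// ge_min lexx orbT.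
have [K1 H1] := Xq _ eta0.
have t0 i : (0 < i)%N -> 0 < T i.+1 - T i by move=> i0; rewrite subr_gt0 Tinc.
have [K2 H2] := psum_equiv t0 qTa eta0.
exists (eta * `|K2| + K1 + K2 + `|a * T 1%N| + eps * `|T 1%N|) => n n0.
have := H1 n n0; have := H2 n n0; rewrite psum_telescope//.
set B := psum q n; set U := T n - T 1%N => h2 h1.
have U0 : 0 <= U.
  by rewrite /U -psum_telescope//; apply: psum_ge0 => i i0; exact/ltW/t0.
have BU : B <= (`|a| + eta) * U + `|K2|.
  have : a * U <= `|a| * U by rewrite ler_wpM2r// ler_norm.
  have := ler_norm (B - a * U); have := ler_norm K2; lra.
have XU : `|X n - a * U| <= eta * U + K2 + (eta * B + K1).
  have -> : X n - a * U = (X n - B) + (B - a * U) by ring.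
  by rewrite (le_trans (ler_normD _ _))// addrC lerD.
have etaB : eta * B <= eta * (`|a| + 1) * U + eta * `|K2|.
  have : eta * B <= eta * ((`|a| + eta) * U + `|K2|) by rewrite ler_wpM2l// ltW.
  have : eta * (eta * U) <= eta * (1 * U) by rewrite ler_wpM2l ?ler_wpM2r// ltW.
  lra.
have etaU : eta * (`|a| + 2) * U <= eps * U by rewrite ler_wpM2r.
have -> : X n - a * T n = (X n - a * U) - a * T 1%N by rewrite /U; ring.
have := ler_normB (X n - a * U) (a * T 1%N).
have : - (eps * T 1%N) <= eps * `|T 1%N| by rewrite -mulrN ler_wpM2l ?(ltW eps0)// -normrN ler_norm.
have : eps * U = eps * T n - eps * T 1%N by rewrite /U; ring.
lra.
Qed.

Lemma tracks_cvg X q T a : tracks X (psum q) ->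
  (forall i, (0 < i)%N -> T i < T i.+1) -> T @ \oo --> +oo ->
  (fun i => q i / (T i.+1 - T i)) @ \oo --> a ->
  (fun n => (T n)^-1 * X n) @ \oo --> a.
Proof.
move=> Xq Tinc Ty qTa; apply/cvgrPdist_le => eps eps0.
have e20 : 0 < eps / 2 by rewrite divr_gt0.
have [K HK] := tracks_equiv Xq Tinc qTa e20.
have /cvgryPge/(_ (Num.max 1 (K / (eps / 2)))) TK := Ty.
near=> n.
have n0 : (0 < n)%N by near: n; exact: nbhs_infty_gt.
have : Num.max 1 (K / (eps / 2)) <= T n by near: n.
rewrite ge_max => /andP[T1 TKn].
have T0 : 0 < T n by exact: lt_le_trans T1.
have -> : (T n)^-1 * X n = (X n - a * T n) / T n + a.
  by rewrite mulrBl mulfK ?gt_eqF// subrK mulrC.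
rewrite opprD addrCA subrr addr0 normrN normrM normfV (gtr0_norm T0) ler_pdivrMr//.
rewrite (le_trans (HK n n0))//.
by rewrite ler_pdivrMr// in TKn; lra.
Unshelve. all: by end_near. Qed.

(** The antiderivative of [x `^ (e - 1)], in its three regimes. *)
Definition pow_primitive e (n : nat) : R :=
  if e == 0 then ln n%:R else n%:R `^ e / e.

Lemma pow_primitive_incr e i : (0 < i)%N -> pow_primitive e i < pow_primitive e i.+1.
Proof.
move=> i0; rewrite /pow_primitive; have ip : 0 < i%:R :> R by rewrite ltr0n.
have ii : i%:R < i.+1%:R :> R by rewrite ltr_nat.
have [e0|e0|e0] := ltrgt0P e; last by rewrite ltr_ln ?posrE// ltr0n.
  by rewrite ltr_pM2r ?invr_gt0// gt0_ltr_powR// ?nnegrE ltW.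
rewrite ltr_nM2r ?invr_lt0//.
have -> : e = - - e by rewrite opprK.
rewrite [X in X < _]powRN [X in _ < X]powRN ltf_pV2 ?posrE ?powR_gt0 ?ltr0n//.
by rewrite gt0_ltr_powR ?oppr_gt0// ?nnegrE ltW.
Qed.

(** The derivative at [1], read along the sequence [1 + 1 / i]. *)
Lemma derive_increment (f : R -> R) c : is_derive (1 : R) (1 : R) f c ->
  (fun i : nat => i%:R * (f (1 + i%:R^-1) - f 1)) @ \oo --> c.
Proof.
move=> fc; rewrite -cvg_shiftS /=.
have := @ex_derive _ _ _ _ _ _ _ fc; rewrite /derivable => /cvg_ex [l Hl].
have lc : l = c by have <- := @derive_val _ _ _ _ _ _ _ fc; apply/esym/cvg_lim.
rewrite lc in Hl; move/cvgr_dnbhsP : Hl => /(_ (fun n => n.+1%:R^-1)).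
have h : (forall n, (n.+1%:R^-1 : R) != 0) /\ (n.+1%:R^-1 : R) @[n --> \oo] --> 0.
  by split=> [n|]; [rewrite invr_eq0 pnatr_eq0|exact: cvg_harmonic].
move/(_ h); apply: cvg_trans; apply: near_eq_cvg; near=> n => /=.
rewrite invrK; transitivity (n.+1%:R * (f (n.+1%:R^-1 * 1 + 1) - f 1)) => //.
by rewrite mulr1 [_ + 1]addrC.
Unshelve. all: by end_near. Qed.

Lemma pow_primitive_increment e :
  (fun i => (pow_primitive e i.+1 - pow_primitive e i) / i%:R `^ (e - 1)) @ \oo
    --> (1 : R).
Proof.
have [e0|e0] := eqVneq e 0.
  have := derive_increment (is_derive1_ln (ltr01 : 0 < 1 :> R)).
  rewrite invr1; apply: cvg_trans; apply: near_eq_cvg; near=> i.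
  have i0 : (0 < i)%N by near: i; exact: nbhs_infty_gt.
  have ip : 0 < i%:R :> R by rewrite ltr0n.
  rewrite /pow_primitive e0 eqxx sub0r powR_inv1 ?ltW// invrK mulrC; congr (_ * _).
  rewrite ln1 subr0 -ln_div ?posrE ?ltr0n//; congr ln.
  by rewrite -natr1 mulrDl divff ?gt_eqF// mul1r.
have := cvgM (cvg_cst e^-1) (derive_increment (is_derive1_powR e (ltr01 : 0 < 1 :> R))).
rewrite powR1 mulr1 mulVf// => h; apply: (cvg_trans _ (h _ _)); apply: near_eq_cvg; near=> i.
have i0 : (0 < i)%N by near: i; exact: nbhs_infty_gt.
have ip : 0 < i%:R :> R by rewrite ltr0n.
rewrite /pow_primitive (negbTE e0) -mulrBl powRB; last first.
  by rewrite [_%:R == 0]gt_eqF// implybT.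
rewrite powRr1 ?ltW//.
have -> : i.+1%:R = i%:R * (1 + i%:R^-1) :> R.
  by rewrite -natr1 mulrDr divff ?gt_eqF// mulr1.
rewrite powRM ?ltW// ?addr_gt0 ?invr_gt0//.
have pi0 : i%:R `^ e != 0 :> R by rewrite gt_eqF// powR_gt0.
by rewrite /=; field; rewrite pi0 e0 gt_eqF.
Unshelve. all: by end_near. Qed.

Lemma powR_natr_cvgy e : 0 < e -> (fun n : nat => n%:R `^ e : R) @ \oo --> +oo.
Proof.
move=> e0; apply/cvgryPge => A.
near=> n; have : (Num.max 1 A) `^ (e^-1) <= n%:R by near: n; exact: nbhs_infty_ger.
move=> /(ge0_ler_powR (ltW e0)); rewrite !nnegrE powR_ge0 ler0n => /(_ isT isT).
rewrite -powRrM mulVf ?gt_eqF// powRr1; last by rewrite le_max ler01.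
by apply: le_trans; rewrite le_max lexx orbT.
Unshelve. all: by end_near. Qed.

Lemma powR_natr_cvg0 e : e < 0 -> (fun n : nat => n%:R `^ e : R) @ \oo --> 0.
Proof.
move=> e0; have e1 : 0 < - e by rewrite oppr_gt0.
have -> : (fun n : nat => n%:R `^ e : R) = (fun n : nat => (n%:R `^ (- e))^-1).
  by apply/funext => n /=; rewrite -powRN opprK.
have pos : \forall n \near \oo, 0 < n%:R `^ (- e) :> R.
  near=> n; rewrite powR_gt0// ltr0n; near: n; exact: nbhs_infty_gt.
by have [_ h] := gtr0_cvgV0 pos; apply: h; exact: powR_natr_cvgy.
Unshelve. all: by end_near. Qed.

Lemma ln_natr_cvgy : (fun n : nat => ln n%:R : R) @ \oo --> +oo.
Proof.
apply/cvgryPge => A; near=> n.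
have n0 : (0 < n)%N by near: n; exact: nbhs_infty_gt.
have An : expR A <= n%:R by near: n; exact: nbhs_infty_ger.
by rewrite -(expRK A) ler_ln ?posrE ?expR_gt0 ?ltr0n.
Unshelve. all: by end_near. Qed.

(** If the intensity [q] behaves like [a * x `^ (e - 1)], then [X] behaves like
    [a] times the antiderivative: polynomial, logarithmic or bounded growth
    according to the sign of [e]. *)
Section pow_density.
Variables (X q : nat -> R) (a e : R).
Hypothesis Xq : tracks X (psum q).
Hypothesis qa : (fun i => q i / i%:R `^ (e - 1)) @ \oo --> a.

Let qTa : (fun i => q i / (pow_primitive e i.+1 - pow_primitive e i)) @ \oo --> a.
Proof.
have /(cvgV (oner_neq0 _)) := pow_primitive_increment e; rewrite invr1.
move=> /(cvgM qa); rewrite mulr1; apply: cvg_trans; apply: near_eq_cvg.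
near=> i; have i0 : (0 < i)%N by near: i; exact: nbhs_infty_gt.
have pi0 : i%:R `^ (e - 1) != 0 :> R by rewrite gt_eqF// powR_gt0 ?ltr0n.
have dT : pow_primitive e i.+1 - pow_primitive e i != 0.
  by rewrite gt_eqF// subr_gt0 pow_primitive_incr.
by rewrite /= invf_div mulrA divfK.
Unshelve. all: by end_near. Qed.

Lemma tracks_powR : 0 < e -> (fun n : nat => (n%:R `^ e)^-1 * X n) @ \oo --> a / e.
Proof.
move=> e0; have Ty : pow_primitive e @ \oo --> +oo.
  rewrite /pow_primitive gt_eqF//.
  apply/cvgryPge => A; have /cvgryPge/(_ (A * e)) := powR_natr_cvgy e0.
  by apply: filterS => n; rewrite ler_pdivlMr.
have Xa := tracks_cvg Xq (pow_primitive_incr e) Ty qTa.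
apply: (cvg_trans _ (cvgM Xa (cvg_cst e^-1))); apply: near_eq_cvg.
near=> n => /=; rewrite /pow_primitive gt_eqF// invf_div.
have n0 : (0 < n)%N by near: n; exact: nbhs_infty_gt.
by field; rewrite !gt_eqF// powR_gt0 ?ltr0n.
Unshelve. all: by end_near. Qed.

Lemma tracks_ln : e = 0 -> (fun n : nat => (ln n%:R)^-1 * X n) @ \oo --> a.
Proof.
move=> e0; have Ty : pow_primitive e @ \oo --> +oo.
  by rewrite /pow_primitive e0 eqxx; exact: ln_natr_cvgy.
have := tracks_cvg Xq (pow_primitive_incr e) Ty qTa.
by rewrite /pow_primitive e0 eqxx.
Qed.

Lemma tracks_bounded : e < 0 -> exists K, forall n, (0 < n)%N -> X n <= K.
Proof.
move=> e0; have [K HK] := tracks_equiv Xq (pow_primitive_incr e) qTa ltr01.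
have T1 n : (0 < n)%N -> `|pow_primitive e n| <= `|e|^-1.
  move=> n0; rewrite /pow_primitive lt_eqF// normrM normfV ler_piMl ?invr_ge0//.
  rewrite ger0_norm ?powR_ge0// -[leRHS](powRr0 n%:R) ler_powR ?ler1n//; exact: ltW.
exists (`|a| * `|e|^-1 + `|e|^-1 + K) => n n0.
have := HK n n0; have := ler_norm (X n - a * pow_primitive e n).
have := ler_norm (pow_primitive e n); have := T1 n n0.
have := ler_norm (a * pow_primitive e n); rewrite normrM.
have : `|a| * `|pow_primitive e n| <= `|a| * `|e|^-1 by rewrite ler_wpM2l// T1.
lra.
Qed.

End pow_density.

End asymptotics.

(** * Counting processes follow their compensators *)

Section counting.
Context d (T : measurableType d) (R : realType) (P : probability T R).
Variables (w : nat -> R) (G : nat -> T -> graph).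
Hypothesis w_gt0 : forall k, (0 < k)%N -> 0 < w k.
Hypothesis hG : preferential_attachment P w G.

Definition hit_prob (A : graph -> pred nat) (g : graph) : R :=
  \sum_(x < nvertices g | A g x) target_prob w g x.

Lemma hit_prob_ge0 A n g : grown n g -> 0 <= hit_prob A g.
Proof.
by move=> hg; apply: sumr_ge0 => x _; exact: (target_prob_ge0 w_gt0 hg).
Qed.

(** From [1 - x <= expR (- x)]. *)
Lemma expR_quadratic (x : R) : x <= 2^-1 -> expR x - 1 <= x + 2 * x ^+ 2.
Proof.
move=> x2; have x1 : 0 < 1 - x by lra.
have : expR x <= (1 - x)^-1.
  by rewrite -[X in X <= _]invrK lef_pV2 ?posrE ?invr_gt0 ?expR_gt0// -expRN expR_ge1Dx.
rewrite -(ler_pM2r x1) mulVf ?gt_eqF// => h.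
have : 0 <= x ^+ 2 * (1 - 2 * x) by rewrite mulr_ge0 ?sqr_ge0//; lra.
move=> h2; rewrite -(ler_pM2r x1); nra.
Qed.

Lemma hit_exp_supermartingale (f : graph -> R) (A : graph -> pred nat) (l : R) :
  (forall n g x, grown n g -> (x < nvertices g)%N ->
    f (attach g x) = f g + (A g x)%:R) ->
  forall n g, grown n g -> next_mean w (fun g => expR (l * f g)) g <=
    expR ((expR l - 1) * hit_prob A g) * expR (l * f g).
Proof.
move=> fA n g hg; rewrite /next_mean.
have E (x : 'I_(nvertices g)) : target_prob w g x * expR (l * f (attach g x)) =
    (target_prob w g x + (expR l - 1) * (if A g x then target_prob w g x else 0))
    * expR (l * f g).
  rewrite (fA _ _ _ hg)// mulrDr expRD; case: (A g x).
    by rewrite mulr1; ring.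
  by rewrite mulr0 expR0; ring.
rewrite (eq_bigr _ (fun x _ => E x)) -mulr_suml ler_wpM2r ?expR_ge0//.
rewrite big_split/= (sum_target_prob w_gt0 hg) -mulr_sumr -big_mkcond/=.
exact: expR_ge1Dx.
Qed.

(** The exponential supermartingales of rates [l] and [- l] bound the count by
    [(1 + O(l))] times its compensator from both sides. *)
Lemma count_tracks (f : graph -> R) (A : graph -> pred nat) :
  (forall n g x, grown n g -> (x < nvertices g)%N ->
    f (attach g x) = f g + (A g x)%:R) ->
  {ae P, forall t, tracks (fun n => f (G n t))
                          (psum (fun i => hit_prob A (G i t)))}.
Proof.
move=> fA.
have H l : {ae P, forall t, exists K, forall n, (0 < n)%N ->
    l * f (G n t) <= K + (expR l - 1) * psum (fun i => hit_prob A (G i t)) n}.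
  have := supermartingale_bounded hG
    (fun n g hg => expR_ge0 (l * f g))
    (fun n g hg => expR_gt0 ((expR l - 1) * hit_prob A g))
    (hit_exp_supermartingale l fA).
  apply: filterS => t [K K0 HK]; exists (ln K) => n n0.
  rewrite -ler_expR expRD lnK ?posrE// /psum mulr_sumr expR_sum.
  exact: HK n n0.
have /ae_foralln H1 : forall m, {ae P, forall t, exists K, forall n, (0 < n)%N ->
    m.+2%:R^-1 * f (G n t) <= K + (expR m.+2%:R^-1 - 1) *
      psum (fun i => hit_prob A (G i t)) n} by move=> m; exact: H.
have /ae_foralln H2 : forall m, {ae P, forall t, exists K, forall n, (0 < n)%N ->
    - m.+2%:R^-1 * f (G n t) <= K + (expR (- m.+2%:R^-1) - 1) *
      psum (fun i => hit_prob A (G i t)) n} by move=> m; exact: H.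
apply: filterS2 H1 H2 => t H1 H2 eps eps0.
have [m] : exists m : nat, 2 * m.+2%:R^-1 <= eps.
  have [m] := ltr_add_invr (divr_gt0 eps0 (ltr0n _ 2)); rewrite add0r => h; exists m.
  rewrite mulrC -ler_pdivlMr// (le_trans _ (ltW h))// lef_pV2 ?posrE// ler_nat//.
set l : R := m.+2%:R^-1 => leps.
have l0 : 0 < l by rewrite invr_gt0.
have l2 : l <= 2^-1 by rewrite lef_pV2 ?posrE// ler_nat.
have [K1 HK1] := H1 m; have [K2 HK2] := H2 m.
exists (`|K1| / l + `|K2| / l) => n n0.
have := HK1 n n0; have := HK2 n n0; rewrite -/l.
set X := f _; set B := psum _ n => h2 h1.
have B0 : 0 <= B.
  by apply: psum_ge0 => i i0; exact: hit_prob_ge0 (G_grown hG t i0).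
have llB : 2 * l * l * B <= eps * l * B by rewrite !ler_wpM2r// ltW.
have u1 : l * X <= l * (`|K1| / l + (1 + eps) * B).
  rewrite mulrDr [l * (_ / l)]mulrC divfK ?gt_eqF//.
  have := ler_wpM2r B0 (expR_quadratic l2); have := ler_norm K1.
  by rewrite expr2; lra.
have u2 : l * ((1 - eps) * B - `|K2| / l) <= l * X.
  rewrite mulrBr [l * (_ / l)]mulrC divfK ?gt_eqF//.
  have /expR_quadratic /(ler_wpM2r B0) : - l <= 2^-1 by lra.
  by have := ler_norm K2; rewrite sqrrN expr2; lra.
rewrite !ler_pM2l// in u1 u2.
have n1 : 0 <= `|K1| / l by rewrite divr_ge0// ltW.
have n2 : 0 <= `|K2| / l by rewrite divr_ge0// ltW.
rewrite ler_norml; lra.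
Qed.

End counting.

Section power_weight.
Variables (R : realType) (gamma : R).
Hypothesis gamma1 : 1 < gamma.

Lemma weight_gt0 k : (0 < k)%N -> 0 < weight gamma k.
Proof. by move=> k0; rewrite /weight powR_gt0// ltr0n. Qed.

Lemma weight_homo : {homo weight gamma : i j / (i <= j)%N >-> i <= j}.
Proof.
move=> i j ij; rewrite /weight ge0_ler_powR ?nnegrE ?ler0n ?ler_nat//.
by have := gamma1; lra.
Qed.

Lemma weight_split k : weight gamma k = k%:R * k%:R `^ (gamma - 1).
Proof.
have [->|k0] := posnP k; last by rewrite /weight mulr_powRB1 ?ler0n//; have := gamma1; lra.
by rewrite /weight mul0r powR0// gt_eqF//; have := gamma1; lra.
Qed.

Lemma total_weight_le_Vmax n g : grown n g ->
  total_weight (weight gamma) g <= 2 * n%:R * (Vmax g)%:R `^ (gamma - 1).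
Proof.
move=> hg; have -> : 2 * n%:R = \sum_(x < nvertices g) (deg g x)%:R :> R.
  by rewrite -natrM -(sum_deg hg) natr_sum.
rewrite mulr_suml; apply: ler_sum => x _; rewrite weight_split ler_wpM2l//.
rewrite ge0_ler_powR ?nnegrE ?ler0n ?ler_nat//; last exact: deg_le_Vmax.
by have := gamma1; lra.
Qed.

(** Since [gamma > 1], a vertex of maximal degree attracts at least the share it
    would get under linear attachment. *)
Lemma target_prob_Vmax n g h : grown n g -> (h < nvertices g)%N ->
  deg g h = Vmax g -> (Vmax g)%:R / (2 * n%:R) <= target_prob (weight gamma) g h.
Proof.
move=> hg hlt dh; have S0 := total_weight_gt0 weight_gt0 hg.
have n0 : 0 < n%:R :> R by rewrite ltr0n; exact: grown_gt0 hg.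
rewrite /target_prob dh ler_pdivrMr ?mulr_gt0// mulrAC ler_pdivlMr//.
rewrite [leRHS]mulrC weight_split [X in _ <= X]mulrCA ler_wpM2l//.
exact: total_weight_le_Vmax.
Qed.

End power_weight.

(** * Polynomial growth of the maximal degree *)

Section growth.
Context d (T : measurableType d) (R : realType) (P : probability T R).
Variables (gamma : R) (G : nat -> T -> graph).
Hypothesis gamma1 : 1 < gamma.
Hypothesis hG : preferential_attachment P (weight gamma) G.

Local Notation w := (weight gamma).

(** Only the two targets [x] and [h] matter in the estimates below. *)
Lemma next_mean_le n g (F : graph -> R) c u v x h : grown n g ->
  (x < nvertices g)%N -> (h < nvertices g)%N ->
  (forall z, (z < nvertices g)%N ->
    F (attach g z) <= c + (z == x)%:R * u + (z == h)%:R * v) ->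
  next_mean w F g <= c + target_prob w g x * u + target_prob w g h * v.
Proof.
move=> hg xlt hlt Fle.
have single y s : (y < nvertices g)%N ->
    \sum_(z < nvertices g) target_prob w g z * ((z == y :> nat)%:R * s) =
    target_prob w g y * s.
  move=> ylt; rewrite (bigD1 (Ordinal ylt))//= eqxx mul1r big1 ?addr0// => i iy.
  have /negbTE -> : (i != y :> nat) by apply: contra iy => /eqP ?; apply/eqP/val_inj.
  by rewrite mul0r mulr0.
have -> : c + target_prob w g x * u + target_prob w g h * v =
    \sum_(z < nvertices g) target_prob w g z *
      (c + (z == x :> nat)%:R * u + (z == h :> nat)%:R * v).
  under eq_bigr do rewrite !mulrDr.
  rewrite !big_split/= !single// -mulr_suml.
  by rewrite (sum_target_prob (@weight_gt0 R gamma) hg) mul1r.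
apply: ler_sum => z _; rewrite ler_wpM2l ?Fle//.
exact: (target_prob_ge0 (@weight_gt0 R gamma) hg).
Qed.

Lemma next_mean_bound n g (F : graph -> R) c : grown n g ->
  (forall z, (z < nvertices g)%N -> F (attach g z) <= c) -> next_mean w F g <= c.
Proof.
move=> hg Fc; have v0 : (0 < nvertices g)%N by rewrite (grown_nvertices hg).
have := @next_mean_le n g F c 0 0 0%N 0%N hg v0 v0.
by rewrite !mulr0 !addr0; apply => z zlt; rewrite !mulr0 !addr0 Fc.
Qed.

Lemma Vmax_attach_ge n g z : grown n g -> (z < nvertices g)%N ->
  (Vmax g <= Vmax (attach g z))%N.
Proof. by move=> hg zlt; rewrite (Vmax_attach hg)// leq_maxl. Qed.

Lemma Vmax_attach_hub n g h : grown n g -> (h < nvertices g)%N ->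
  deg g h = Vmax g -> Vmax (attach g h) = (Vmax g).+1.
Proof. by move=> hg hlt dh; rewrite (Vmax_attach hg)// dh; apply/maxn_idPr. Qed.

(** The hitting probability of the maximal degree makes its inverse decrease, on
    average, at least like [n^(-1/4)]. *)
Lemma inv_Vmax_supermartingale n g : grown n g ->
  next_mean w (fun g => (Vmax g)%:R^-1) g <=
  (1 - (4 * (size (edges g))%:R)^-1) * (Vmax g)%:R^-1.
Proof.
move=> hg; rewrite (grown_edges hg).
have [h hlt dh] := Vmax_attained hg.
have M0 := Vmax_gt0 hg; have n0 := grown_gt0 hg.
have Mp : 1 <= (Vmax g)%:R :> R by rewrite ler1n.
have Mpos : 0 < (Vmax g)%:R :> R by rewrite ltr0n.
have np : 0 < n%:R :> R by rewrite ltr0n.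
have := @next_mean_le n g (fun g => (Vmax g)%:R^-1) (Vmax g)%:R^-1 0
  ((Vmax g).+1%:R^-1 - (Vmax g)%:R^-1) h h hg hlt hlt.
rewrite mulr0 addr0 => /(_ _)/le_trans; apply.
  move=> z zlt; rewrite mulr0 addr0; have [->|zh] := eqVneq z h.
    by rewrite mul1r (Vmax_attach_hub hg)// addrC subrK.
  rewrite mul0r addr0 lef_pV2 ?posrE ?ltr0n ?ler_nat//.
    exact: Vmax_attach_ge hg zlt.
  by rewrite (leq_trans M0)//; exact: Vmax_attach_ge hg zlt.
have := target_prob_Vmax gamma1 hg hlt dh.
set p := target_prob _ _ _ => hp.
rewrite -natr1 mulrBl mul1r lerD2l.
set M : R := (Vmax g)%:R in Mp Mpos hp *.
have M1 : 0 < M + 1 by lra.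
have -> : (M + 1)^-1 - M^-1 = - (M * (M + 1))^-1.
  by field; rewrite !gt_eqF//.
rewrite mulrN lerN2 -invfM.
apply: (@le_trans _ _ (M / (2 * n%:R) * (M * (M + 1))^-1)); last first.
  by rewrite ler_wpM2r// invr_ge0 mulr_ge0 ?ltW.
have -> : M / (2 * n%:R) / (M * (M + 1)) = (2 * n%:R * (M + 1))^-1.
  by field; rewrite !gt_eqF.
rewrite lef_pV2 ?posrE ?mulr_gt0//; nra.
Qed.

(** The product decreases like [n `^ (- 1 / 4)]; taking fourth powers avoids the
    root. *)
Lemma prod_quarter n : (0 < n)%N ->
  (\prod_(1 <= j < n) (1 - (4 * j%:R)^-1 : R)) ^+ 4 <= n%:R^-1.
Proof.
elim: n => // -[|n] IH _.
  by rewrite big_geq// expr1n invr1.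
rewrite big_nat_recr//= exprMn.
apply: (@le_trans _ _ (n.+1%:R^-1 * (1 - (4 * n.+1%:R)^-1) ^+ 4)).
  by rewrite ler_wpM2r ?IH// exprn_even_ge0.
set y : R := n.+1%:R; have y1 : 1 <= y by rewrite ler1n.
have -> : n.+2%:R = y + 1 :> R by rewrite natr1.
set s := (4 * y)^-1.
have sy : y * s = 4^-1 by rewrite /s; field; lra.
have s0 : 0 < s by rewrite invr_gt0; lra.
have s1 : s <= 4^-1 by rewrite lef_pV2 ?posrE; lra.
rewrite mulrC ler_pdivrMr; last lra.
rewrite -[leRHS]mulrC ler_pdivlMr; last lra.
(* Bernoulli: [(1 - s)^4 (1 + 4 s) <= 1]. *)
have -> : y + 1 = y * (1 + 4 * s) by rewrite mulrDr mulrCA sy; lra.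
rewrite mulrCA -[leRHS]mulr1 ler_wpM2l//.
have -> : (1 - s) ^+ 4 * (1 + 4 * s) =
  1 - s ^+ 2 * (10 - 20 * s + 15 * s ^+ 2 - 4 * s ^+ 3) by ring.
rewrite gerBl mulr_ge0 ?sqr_ge0//.
have : 0 <= s ^+ 2 * (15 - 4 * s) by rewrite mulr_ge0 ?sqr_ge0//; lra.
by rewrite !exprS expr0 mulr1; lra.
Qed.

(** A polynomial lower bound, with a poor exponent that is improved later. *)
Lemma Vmax_growth : {ae P, forall t, exists2 K : R, 0 < K &
  forall n, (0 < n)%N -> n%:R <= K * (Vmax (G n t))%:R ^+ 4}.
Proof.
have r0 n g : grown n g -> 0 < 1 - (4 * (size (edges g))%:R)^-1 :> R.
  move=> hg; rewrite (grown_edges hg) subr_gt0.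
  have n1 : 1 <= n%:R :> R by rewrite ler1n; exact: grown_gt0 hg.
  by rewrite invf_lt1; lra.
have F0 n g : grown n g -> 0 <= (Vmax g)%:R^-1 :> R by move=> _; rewrite invr_ge0.
apply: filterS (supermartingale_bounded hG F0 r0 inv_Vmax_supermartingale).
move=> t [K K0 HK]; exists (K ^+ 4); first exact: exprn_gt0.
move=> n n0; have M0 : 0 < (Vmax (G n t))%:R :> R.
  by rewrite ltr0n; exact: Vmax_gt0 (G_grown hG t n0).
have := HK n n0; rewrite (eq_big_nat _ _ (F2 := fun j => 1 - (4 * j%:R)^-1 : R)); last first.
  by move=> j /andP[j0 _]; rewrite (grown_edges (G_grown hG t j0)).
set p := \prod_(_ <= _ < _) _ => h.
have p0 : 0 <= p.
  apply: prodr_ge0 => -[|j] _; first by rewrite mulr0 invr0 subr0.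
  have j1 : 1 <= j.+1%:R :> R by rewrite ler1n.
  by rewrite subr_ge0 invf_le1; lra.
have pn : p ^+ 4 <= n%:R^-1 by exact: prod_quarter.
have h4 : (Vmax (G n t))%:R^-1 ^+ 4 <= (K * p) ^+ 4.
  by rewrite lerXn2r ?nnegrE ?invr_ge0 ?mulr_ge0 ?(ltW M0) ?(ltW K0).
have n0r : 0 < n%:R :> R by rewrite ltr0n.
rewrite -ler_pdivrMr ?exprn_gt0// -exprVn.
have : (K * p) ^+ 4 <= K ^+ 4 * n%:R^-1.
  by rewrite exprMn ler_wpM2l// exprn_ge0// ltW.
move=> /(le_trans h4); rewrite ler_pdivlMr// mulrC.
by [].
Qed.

End growth.

(** * Finitely many vertices reach a large degree *)

Section few_large_degrees.
Context d (T : measurableType d) (R : realType) (P : probability T R).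
Variables (gamma : R) (G : nat -> T -> graph).
Hypothesis gamma1 : 1 < gamma.
Hypothesis hG : preferential_attachment P (weight gamma) G.

Local Notation w := (weight gamma).
Local Notation delta := (gamma - 1).

Let delta0 : 0 < delta. Proof. by rewrite subr_gt0. Qed.

(** The derivative of [x `^ (- delta)] is [- delta * x `^ (- gamma)], so one step of
    a vertex of degree [D] lowers this function by an amount that [w D]
    compensates. *)
Lemma powR_decrement (D : nat) : (0 < D)%N ->
  delta / (2 + delta) <= w D * (D%:R `^ (- delta) - D.+1%:R `^ (- delta)).
Proof.
move=> D0; have d0 := delta0; have Dp : 0 < D%:R :> R by rewrite ltr0n.
have D1 : 1 <= D%:R :> R by rewrite ler1n.
have wD : w D * D%:R `^ (- delta) = D%:R.
  by rewrite weight_split// -mulrA powRN mulfV ?mulr1// gt_eqF// powR_gt0.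
set y : R := delta / (D%:R + 1).
have y0 : 0 < y by rewrite divr_gt0//; lra.
have D1E : D.+1%:R `^ (- delta) <= D%:R `^ (- delta) / (1 + y).
  have -> : D.+1%:R = D%:R * (1 + D%:R^-1) :> R.
    by rewrite mulrDr mulfV ?gt_eqF// mulr1 natr1.
  have i0 : 0 < D%:R^-1 :> R by rewrite invr_gt0.
  rewrite powRM ?(ltW Dp)//.
  rewrite ler_wpM2l ?powR_ge0// powRN lef_pV2 ?posrE ?powR_gt0; try lra.
  rewrite /powR gt_eqF; last lra.
  apply: le_trans (expR_ge1Dx _); rewrite lerD2l /y ler_wpM2l ?(ltW delta0)//.
  have -> : 1 + D%:R^-1 = (1 - (D%:R + 1)^-1)^-1 :> R.
    field; rewrite addrK !gt_eqF//; lra.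
  rewrite lnV ?posrE; last by rewrite subr_gt0 invf_lt1; lra.
  rewrite lerNr; apply: le_ln1Dx; rewrite ltrNr opprK invf_lt1; lra.
apply: (@le_trans _ _ (w D * (D%:R `^ (- delta) - D%:R `^ (- delta) / (1 + y)))).
  have -> : w D * (D%:R `^ (- delta) - D%:R `^ (- delta) / (1 + y)) =
      D%:R * y / (1 + y).
    by rewrite -[X in X - _]mulr1 -mulrBr mulrA wD; field; rewrite gt_eqF//; lra.
  have -> : D%:R * y / (1 + y) = D%:R * delta / (D%:R + 1 + delta).
    by rewrite /y; field; rewrite !gt_eqF//; lra.
  rewrite ler_pdivlMr; last lra.
  rewrite mulrAC ler_pdivrMr; last lra.
  have : 0 <= delta * (1 + delta) * (D%:R - 1) by rewrite !mulr_ge0//; lra.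
  lra.
rewrite ler_wpM2l ?lerD2l ?lerN2//; exact/ltW/weight_gt0.
Qed.

Variable k : nat.
(** A new vertex climbs to degree [k] with probability of order
    [D `^ (- delta * (k - 1))], where [D] is the maximal degree.  As [D ^+ 4] is at
    least of order [n], the constant [8] makes these probabilities summable. *)
Hypothesis k_large : 8 <= delta * (k.-1)%:R.

(* The least constant for which [potential_decrement] follows from
   [powR_decrement]. *)
Let B : R := w k * (2 + delta) / delta.

(** [potential D] is, up to a constant, the chance that a vertex of fixed degree
    is chosen once more while another vertex of degree [D] keeps competing; so
    [potential D ^+ (k - j)] controls the chance to climb from degree [j] to
    degree [k]. *)
Definition potential (D : nat) : R := B * D%:R `^ (- delta).

Definition climb (j D : nat) : R := potential D ^+ (k - j).

Let k1 : (1 < k)%N.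
Proof.
rewrite ltnNge; apply/negP => kle1; have := k_large.
have -> : k.-1 = 0%N by lia.
by rewrite mulr0; lra.
Qed.

Let B_ge : k%:R `^ delta <= B.
Proof.
have kp : 1 <= k%:R :> R by rewrite ler1n ltnW.
have d0 := delta0; have kd : 0 < k%:R `^ delta by rewrite powR_gt0; lra.
rewrite /B weight_split// ler_pdivlMr// [k%:R * _]mulrC -!mulrA ler_pM2l//; nra.
Qed.

Let B1 : 1 <= B.
Proof.
apply: le_trans B_ge; have kp : 1 <= k%:R :> R by rewrite ler1n ltnW.
by rewrite -[leLHS](powRr0 k%:R) ler_powR// (ltW delta0).
Qed.

Let B0 : 0 < B. Proof. exact: lt_le_trans B1. Qed.

Lemma potential_ge0 D : 0 <= potential D.
Proof. by rewrite mulr_ge0 ?powR_ge0 ?(ltW B0). Qed.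

Lemma potential_le D D' : (0 < D)%N -> (D <= D')%N -> potential D' <= potential D.
Proof.
move=> D0 DD'; rewrite ler_wpM2l ?(ltW B0)// !powRN.
have D'0 := leq_trans D0 DD'.
rewrite lef_pV2 ?posrE ?powR_gt0 ?ltr0n// ge0_ler_powR ?nnegrE ?ler_nat//.
exact: ltW.
Qed.

Lemma potential_decrement D : (0 < D)%N ->
  w k <= w D * (potential D - potential D.+1).
Proof.
move=> D0; rewrite -mulrBr mulrCA.
apply: (@le_trans _ _ (B * (delta / (2 + delta)))).
  rewrite /B le_eqVlt; apply/orP; left; apply/eqP; field.
  by rewrite !gt_eqF//; have := delta0; lra.
by rewrite ler_wpM2l ?(ltW B0) ?powR_decrement.
Qed.

Lemma climb_ge0 j D : 0 <= climb j D.
Proof. by rewrite exprn_ge0 ?potential_ge0. Qed.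

Lemma climb_le j D D' : (0 < D)%N -> (D <= D')%N -> climb j D' <= climb j D.
Proof.
by move=> D0 DD'; rewrite lerXn2r ?nnegrE ?potential_ge0 ?potential_le.
Qed.

Lemma climb_top j D : (k <= j)%N -> climb j D = 1.
Proof. by rewrite /climb -subn_eq0 => /eqP ->. Qed.

Lemma climb_le_max j D : (0 < D)%N -> climb j D <= B ^+ k.
Proof.
move=> D0; apply: (@le_trans _ _ (B ^+ (k - j))).
  rewrite lerXn2r ?nnegrE ?potential_ge0 ?(ltW B0)//.
  rewrite -[leRHS]mulr1 ler_wpM2l ?(ltW B0)// powRN invf_le1.
    by rewrite -[leLHS](powRr0 D%:R) ler_powR ?ler1n// (ltW delta0).
  by rewrite powR_gt0 ?ltr0n.
by rewrite ler_weXn2l// leq_subr.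
Qed.

Lemma climb_ge1 j D : (0 < D)%N -> (D <= k)%N -> 1 <= climb j D.
Proof.
move=> D0 Dk; apply: exprn_ege1; rewrite /potential powRN ler_pdivlMr ?mul1r.
  apply: le_trans B_ge; rewrite ge0_ler_powR ?nnegrE ?ler_nat//; exact: ltW.
by rewrite powR_gt0 ?ltr0n.
Qed.

Lemma climb_new D : (0 < D)%N -> climb 1 D <= B ^+ k / D%:R ^+ 8.
Proof.
move=> D0; have D1 : 1 <= D%:R :> R by rewrite ler1n.
rewrite /climb /potential exprMn ler_pM ?exprn_ge0 ?(ltW B0) ?powR_ge0//.
- by rewrite ler_weXn2l// leq_subr.
rewrite -powR_mulrn ?powR_ge0// -powRrM mulNr powRN lef_pV2 ?posrE; last first.
- by rewrite exprn_gt0; lra.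
- by rewrite powR_gt0; lra.
by rewrite -powR_mulrn; [rewrite ler_powR// subn1|lra].
Qed.

(** A vertex below level [k] competes with a vertex of maximal degree: a hit of the
    former multiplies its climbing score by [1 / potential], a hit of the latter
    lowers it, and [potential_decrement] balances the two. *)
Lemma climb_supermartingale n g x : grown n g -> (x < nvertices g)%N ->
  (k <= Vmax g)%N ->
  next_mean w (fun g' => climb (deg g' x) (Vmax g')) g <= climb (deg g x) (Vmax g).
Proof.
move=> hg xlt kM; have M0 := Vmax_gt0 hg.
have [kd|dk] := leqP k (deg g x).
  apply: (next_mean_bound _ hg) => z zlt; rewrite !climb_top//.
  by rewrite deg_attach_old// (leq_trans kd)// leq_addr.
have [h hlt dh] := Vmax_attained hg.
have xh : x != h by apply: contraTneq dk => ->; rewrite dh -leqNgt.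
set r := potential (Vmax g); set r' := potential (Vmax g).+1.
have r0 : 0 <= r by exact: potential_ge0.
have r'0 : 0 <= r' by exact: potential_ge0.
have r'r : r' <= r by exact: potential_le.
have [m mE] : exists m, (k - deg g x = m.+1)%N by exists (k - deg g x).-1; lia.
have mE' : (k - (deg g x).+1 = m)%N by lia.
have := @next_mean_le R gamma n g (fun g' => climb (deg g' x) (Vmax g'))
  (climb (deg g x) (Vmax g)) (r ^+ m) (- (r ^+ m * (r - r'))) x h hg xlt hlt.
move=> /(_ _)/le_trans; apply.
  move=> z zlt; have Mz := Vmax_attach_ge hg zlt.
  rewrite deg_attach_old//; have [->|zx] := eqVneq z x.
    rewrite (negbTE xh) mul0r addr0 mul1r addn1.
    rewrite (le_trans (climb_le _ M0 (Vmax_attach_ge hg xlt)))//.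
    by rewrite /climb mE' ler_wpDl// exprn_ge0.
  rewrite mul0r addr0 addn0; have [->|zh] := eqVneq z h.
    rewrite mul1r (Vmax_attach_hub hg)// /climb mE -/r -/r' !exprS mulrBr.
    have : r' ^+ m <= r ^+ m by rewrite lerXn2r.
    move=> /(ler_wpM2l r'0); lra.
  by rewrite mul0r addr0 climb_le.
rewrite -addrA gerDl mulrN subr_le0 /target_prob dh.
have S0 := total_weight_gt0 (@weight_gt0 R gamma) hg.
rewrite mulrAC [X in _ <= X]mulrAC ler_wpM2r ?invr_ge0 ?(ltW S0)//.
rewrite [X in _ <= X]mulrCA mulrC ler_wpM2l ?exprn_ge0//.
apply: le_trans (potential_decrement M0); apply: weight_homo => //; exact: ltnW.
Qed.

Definition climbers (g : graph) : R := \sum_(x < nvertices g) climb (deg g x) (Vmax g).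

(** Each arrival adds at most [climb 1 (Vmax g)], whence the growth factor.  While
    the maximal degree is below [k] there is no vertex to compete with, but then
    the factor exceeds [1 + B ^+ k] and a crude bound suffices. *)
Lemma climbers_step n g : grown n g ->
  next_mean w (fun g' => 1 + climbers g') g <=
  (1 + B ^+ k * k%:R ^+ 8 / (Vmax g)%:R ^+ 8) * (1 + climbers g).
Proof.
move=> hg; have M0 := Vmax_gt0 hg; have Mp : 0 < (Vmax g)%:R :> R by rewrite ltr0n.
have Bk : 1 <= B ^+ k by exact: exprn_ege1.
have c0 : 0 <= climbers g by apply: sumr_ge0 => x _; exact: climb_ge0.
have k8 : 1 <= k%:R ^+ 8 :> R by rewrite exprn_ege1// ler1n ltnW.
have attachE z : climbers (attach g z) =
  \sum_(x < nvertices g) climb (deg (attach g z) x) (Vmax (attach g z)) +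
  climb (deg (attach g z) (nvertices g)) (Vmax (attach g z)).
  by rewrite /climbers {1}/nvertices /= -/(nvertices g) big_ord_recr.
have [kM|Mk] := leqP k (Vmax g); last first.
  apply: (next_mean_bound _ hg) => z zlt; rewrite attachE.
  have Mz := leq_trans M0 (Vmax_attach_ge hg zlt).
  apply: (@le_trans _ _ (1 + (\sum_(x < nvertices g) B ^+ k + B ^+ k))).
    by rewrite lerD2l lerD ?climb_le_max// ler_sum// => x _; exact: climb_le_max.
  have vc : (nvertices g)%:R <= climbers g.
    have -> : (nvertices g)%:R = \sum_(x < nvertices g) 1 :> R.
      by rewrite sumr_const card_ord.
    by apply: ler_sum => x _; rewrite climb_ge1// ltnW.
  have kM8 : B ^+ k <= B ^+ k * k%:R ^+ 8 / (Vmax g)%:R ^+ 8.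
    rewrite -mulrA ler_peMr ?(le_trans ler01)// ler_pdivlMr ?exprn_gt0// mul1r.
    by rewrite lerXn2r ?nnegrE// ler_nat ltnW.
  rewrite sumr_const card_ord -mulr_natr.
  have := ler_wpM2l (le_trans ler01 Bk) vc.
  have : B ^+ k * (1 + climbers g) <=
      (B ^+ k * k%:R ^+ 8 / (Vmax g)%:R ^+ 8) * (1 + climbers g).
    by rewrite ler_wpM2r// addr_ge0.
  lra.
have nm_split : next_mean w (fun g' => 1 + climbers g') g = 1 +
   (\sum_(x < nvertices g) next_mean w (fun g' => climb (deg g' x) (Vmax g')) g) +
   next_mean w (fun g' => climb (deg g' (nvertices g)) (Vmax g')) g.
  rewrite /next_mean exchange_big/=.
  under eq_bigr do rewrite attachE !mulrDr mulr1 mulr_sumr.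
  by rewrite !big_split/= (sum_target_prob (@weight_gt0 R gamma) hg) addrA.
have new : next_mean w (fun g' => climb (deg g' (nvertices g)) (Vmax g')) g <=
    B ^+ k / (Vmax g)%:R ^+ 8.
  apply: (next_mean_bound _ hg) => z zlt; rewrite (deg_attach_new hg)//.
  by rewrite (le_trans (climb_le _ M0 (Vmax_attach_ge hg zlt)))// climb_new.
have old : \sum_(x < nvertices g)
    next_mean w (fun g' => climb (deg g' x) (Vmax g')) g <= climbers g.
  by apply: ler_sum => x _; exact: climb_supermartingale hg _ _.
rewrite nm_split.
have e0 : 0 <= B ^+ k * k%:R ^+ 8 / (Vmax g)%:R ^+ 8.
  by rewrite divr_ge0 ?mulr_ge0 ?exprn_ge0// (ltW B0).
have : B ^+ k / (Vmax g)%:R ^+ 8 <= B ^+ k * k%:R ^+ 8 / (Vmax g)%:R ^+ 8.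
  rewrite ler_wpM2r ?invr_ge0 ?exprn_ge0// ler_peMr// exprn_ge0// (ltW B0).
  by [].
have := mulr_ge0 e0 c0; lra.
Qed.

Lemma Phi_le_climbers g : (Phi k g)%:R <= climbers g.
Proof.
rewrite PhiE natr_sum; apply: ler_sum => x _.
by case: leqP => kd; [rewrite climb_top|rewrite climb_ge0].
Qed.

(** Compare with the telescoping sum of [1 / (i * (i + 1))]. *)
Lemma psum_inv_sqr n : psum (fun i => (i%:R ^+ 2)^-1 : R) n <= 2.
Proof.
have [->|n0] := posnP n; first by rewrite /psum big_geq.
apply: (@le_trans _ _ (2 * (1 - n%:R^-1))); last first.
  by rewrite -[leRHS]mulr1 ler_wpM2l// gerBl invr_ge0.
elim: n n0 => // -[|n] IH _; first by rewrite psum1 invr1 subrr mulr0.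
rewrite psumS//; apply: le_trans (lerD (IH isT) (lexx _)) _.
rewrite -[n.+2%:R]natr1; set y : R := n.+1%:R; have y1 : 1 <= y by rewrite ler1n.
have -> : 2 * (1 - (y + 1)^-1) = 2 * (1 - y^-1) + (2^-1 * (y * (y + 1)))^-1.
  by field; rewrite !gt_eqF//; lra.
rewrite lerD2l lef_pV2 ?posrE ?exprn_gt0 ?mulr_gt0//; [nra|lra..].
Qed.

Lemma Phi_bounded_at : {ae P, forall t, exists K : R, forall n, (0 < n)%N ->
  (Phi k (G n t))%:R <= K}.
Proof.
set C := B ^+ k * k%:R ^+ 8.
have C0 : 0 <= C by rewrite mulr_ge0 ?exprn_ge0// (ltW B0).
have F0 n g : grown n g -> 0 <= 1 + climbers g.
  by move=> hg; rewrite addr_ge0// sumr_ge0// => x _; exact: climb_ge0.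
have r0 n g : grown n g -> 0 < 1 + C / (Vmax g)%:R ^+ 8.
  by move=> hg; rewrite ltr_wpDr// divr_ge0.
apply: filterS2 (supermartingale_bounded hG F0 r0 climbers_step) (Vmax_growth gamma1 hG).
move=> t [K K0 HK] [L L0 HL]; exists (K * expR (C * (L ^+ 2 * 2))) => n n0.
apply: (le_trans (Phi_le_climbers _)).
apply: (@le_trans _ _ (1 + climbers (G n t))); first by rewrite lerDr.
apply: (le_trans (HK n n0)); rewrite ler_wpM2l ?(ltW K0)//.
apply: (@le_trans _ _ (\prod_(1 <= j < n) expR (C * (L ^+ 2 / j%:R ^+ 2)))).
  rewrite big_nat_cond [leRHS]big_nat_cond; apply: ler_prod => j /andP[/andP[j0 _] _].
  have hj := G_grown hG t j0; rewrite (ltW (r0 _ _ hj))/=.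
  apply: le_trans (expR_ge1Dx _); rewrite lerD2l ler_wpM2l//.
  have M0 : 0 < (Vmax (G j t))%:R :> R by rewrite ltr0n; exact: Vmax_gt0 hj.
  rewrite ler_pdivlMr ?exprn_gt0 ?ltr0n// mulrC ler_pdivrMr ?exprn_gt0//.
  have -> : L ^+ 2 * (Vmax (G j t))%:R ^+ 8 = (L * (Vmax (G j t))%:R ^+ 4) ^+ 2 by ring.
  by rewrite lerXn2r ?nnegrE ?HL// mulr_ge0 ?exprn_ge0// ltW.
rewrite -expR_sum ler_expR -mulr_sumr ler_wpM2l// -mulr_sumr ler_wpM2l ?exprn_ge0 ?(ltW L0)//.
exact: psum_inv_sqr.
Qed.

End few_large_degrees.

Lemma Phi_bounded_ae d (T : measurableType d) (R : realType) (P : probability T R)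
    (gamma : R) (G : nat -> T -> graph) : 1 < gamma ->
  preferential_attachment P (weight gamma) G ->
  exists k, {ae P, forall t, exists K : R, forall n, (0 < n)%N ->
    (Phi k (G n t))%:R <= K}.
Proof.
move=> gamma1 hG; exists (Num.truncn (8 / (gamma - 1))).+2.
apply: (Phi_bounded_at gamma1 hG).
rewrite mulrC -ler_pdivrMr ?subr_gt0//; exact/ltW/truncnS_gt.
Qed.

(** * Two vertices cannot both have unbounded degree *)

Section race.
Context d (T : measurableType d) (R : realType) (P : probability T R).
Variables (gamma : R) (G : nat -> T -> graph).
Hypothesis gamma1 : 1 < gamma.
Hypothesis hG : preferential_attachment P (weight gamma) G.

Local Notation w := (weight gamma).

(** In the continuous-time picture a vertex waits at degree [l] for an exponential
    time of mean [1 / w l]; [clock i] and [clock_var i] are the mean and the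
    variance of the time needed to reach degree [i], as [w 0] and its inverse are
    zero. *)
Definition clock (i : nat) : R := \sum_(l < i) (w l)^-1.
Definition clock_var (i : nat) : R := \sum_(l < i) (w l)^-1 ^+ 2.

Lemma clockS i : clock i.+1 = clock i + (w i)^-1.
Proof. by rewrite /clock big_ord_recr. Qed.

Lemma clock_varS i : clock_var i.+1 = clock_var i + (w i)^-1 ^+ 2.
Proof. by rewrite /clock_var big_ord_recr. Qed.

Let w_ge0 l : 0 <= w l. Proof. exact: powR_ge0. Qed.

Let clock_nd : nondecreasing_seq clock.
Proof. by apply/nondecreasing_seqP => i; rewrite clockS lerDl invr_ge0. Qed.

Let clock_var_nd : nondecreasing_seq clock_var.
Proof. by apply/nondecreasing_seqP => i; rewrite clock_varS lerDl sqr_ge0. Qed.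

Lemma clock_bounded : exists K, forall i, clock i <= K.
Proof.
pose q (i : nat) : R := (w i)^-1.
have qq : tracks (psum q) (psum q).
  move=> eps eps0; exists 0 => n n0; rewrite subrr normr0 addr0.
  by rewrite mulr_ge0 ?(ltW eps0)// psum_ge0// => i _; rewrite invr_ge0.
have q1 : (fun i => q i / i%:R `^ (1 - gamma - 1)) @ \oo --> (1 : R).
  apply: cvg_near_cst; near=> i.
  have i0 : (0 < i)%N by near: i; exact: nbhs_infty_gt.
  have -> : 1 - gamma - 1 = - gamma by ring.
  by rewrite powRN mulfV// invr_eq0 gt_eqF// weight_gt0.
have [|K HK] := tracks_bounded qq q1; first by rewrite subr_lt0.
exists K => i; have g0 : gamma != 0 by rewrite gt_eqF// (lt_trans ltr01).
have [->|i0] := posnP i.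
  rewrite /clock big_ord0; apply: le_trans (HK 1%N isT); rewrite psum1.
  by [].
apply: le_trans (HK i i0); rewrite /clock /psum -(big_mkord predT (fun l => (w l)^-1)).
by rewrite big_ltn// {1}/weight powR0// invr0 add0r.
Unshelve. all: by end_near. Qed.

Lemma inv_weight_le1 l : (w l)^-1 <= 1.
Proof.
have [->|l0] := posnP l; last first.
  rewrite invf_le1 ?weight_gt0// /weight -[leLHS](powRr0 l%:R).
  by rewrite ler_powR ?ler1n// (le_trans ler01) ?(ltW gamma1).
by rewrite /weight powR0 ?invr0 ?ler01// gt_eqF// (lt_trans ltr01).
Qed.

Lemma clock_var_le i : clock_var i <= clock i.
Proof.
apply: ler_sum => l _; rewrite expr2 ler_piMr ?invr_ge0//; exact: inv_weight_le1.
Qed.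

Let clock_cvg : cvgn clock.
Proof.
have [K HK] := clock_bounded; apply: nondecreasing_is_cvgn => //.
by exists K => _ [i _ <-].
Qed.

Let clock_var_cvg : cvgn clock_var.
Proof.
have [K HK] := clock_bounded; apply: nondecreasing_is_cvgn => //.
by exists K => _ [i _ <-]; exact: le_trans (clock_var_le i) (HK i).
Qed.

Definition clock_end : R := limn clock.
Definition clock_var_end : R := limn clock_var.

Let clock_le_end i : clock i <= clock_end.
Proof. exact: nondecreasing_cvgn_le. Qed.

Let clock_var_le_end i : clock_var i <= clock_var_end.
Proof. exact: nondecreasing_cvgn_le. Qed.

(** The lead of one vertex over the other is a martingale whose remaining
    variance [spread] is consumed deterministically, whence the martingale
    [energy]; it tends to zero if both degrees are unbounded. *)
Definition lead (i j : nat) : R := clock i - clock j.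
Definition spread (i j : nat) : R :=
  (clock_var_end - clock_var i) + (clock_var_end - clock_var j).
Definition energy (i j : nat) : R := lead i j ^+ 2 + spread i j.

Let q4 : R := 4 `^ gamma.
Let c : R := 4 + 4 * q4.
Let K : R := 1 + c.

Let q4_gt0 : 0 < q4. Proof. by rewrite powR_gt0. Qed.

(** Adding a multiple of [energy * spread] to the square of [energy] makes it a
    supermartingale: the decrease of [spread] pays for the quadratic variation.  It
    bounds the second moment of [energy]. *)
Definition energy2 (i j : nat) : R := energy i j ^+ 2 + c * energy i j * spread i j.

(** The remaining variance includes the next two jumps, and the second is
    comparable with the first since [i.+1 <= 2 * i]. *)
Lemma spread_jump i j : (0 < i)%N -> (1 + q4) * (w i)^-1 ^+ 2 <= q4 * spread i j.
Proof.
move=> i0; have w0 := weight_gt0 gamma i0; have q0 := q4_gt0.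
have wS : w i.+1 <= 2 `^ gamma * w i.
  rewrite /weight -powRM// ge0_ler_powR ?nnegrE ?mulr_ge0//.
    by have := gamma1; lra.
  by rewrite -natrM ler_nat; lia.
have w1 := weight_gt0 gamma (ltn0Sn i).
have qE : q4 = (2 `^ gamma) ^+ 2.
  rewrite /q4 (_ : 4 = 2 * 2) ?powRM ?expr2//; first by rewrite -natrM.
have jump : (w i)^-1 ^+ 2 <= q4 * (w i.+1)^-1 ^+ 2.
  rewrite qE -exprMn lerXn2r ?nnegrE ?mulr_ge0 ?invr_ge0 ?powR_ge0//.
  by rewrite ler_pdivlMr// mulrC ler_pdivrMr// mulrC.
have := clock_var_le_end i.+2; rewrite !clock_varS.
have := clock_var_le_end j.
rewrite /spread => hj hi.
have : q4 * ((w i)^-1 ^+ 2 + (w i.+1)^-1 ^+ 2) <=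
  q4 * (clock_var_end - clock_var i + (clock_var_end - clock_var j)).
  by rewrite ler_wpM2l ?(ltW q0)//; lra.
lra.
Qed.

Lemma spread_gt0 i j : (0 < i)%N -> 0 < spread i j.
Proof.
move=> i0; rewrite -(pmulr_rgt0 _ q4_gt0); apply: lt_le_trans (spread_jump j i0).
by rewrite mulr_gt0 ?addr_gt0 ?exprn_gt0 ?invr_gt0 ?weight_gt0// q4_gt0.
Qed.

Lemma spreadC i j : spread i j = spread j i.
Proof. by rewrite /spread addrC. Qed.

Lemma energy_gt0 i j : (0 < i)%N -> 0 < energy i j.
Proof. by move=> i0; rewrite ltr_wpDl ?sqr_ge0 ?spread_gt0. Qed.

(** A quadratic form in [W] and [a], whose discriminant has the right sign because
    of the spare jump in [spread_jump]. *)
Lemma energy2_jump_neg (W s a : R) : (1 + q4) * a ^+ 2 <= q4 * s ->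
  4 * W ^+ 2 - c * (W ^+ 2 + s) - 2 * c * W * a <= 0.
Proof.
move=> h; have q0 := q4_gt0.
have : 0 <= (q4 * W + (1 + q4) * a) ^+ 2 by exact: sqr_ge0.
rewrite -(pmulr_rle0 _ q0) /c => h2.
have := ler_wpM2l (_ : 0 <= 1 + q4) h; rewrite addr_ge0 ?(ltW q0)// => /(_ isT).
nra.
Qed.

Lemma energy_drift i j : (0 < i)%N -> (0 < j)%N ->
  w i * (energy i.+1 j - energy i j) + w j * (energy i j.+1 - energy i j) = 0.
Proof.
move=> i0 j0; have wi := weight_gt0 gamma i0; have wj := weight_gt0 gamma j0.
rewrite /energy /lead /spread !clockS !clock_varS; field.
by rewrite !gt_eqF.
Qed.

Lemma energy2_drift i j : (0 < i)%N -> (0 < j)%N ->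
  w i * (energy2 i.+1 j - energy2 i j) + w j * (energy2 i j.+1 - energy2 i j) <= 0.
Proof.
move=> i0 j0; have wi := weight_gt0 gamma i0; have wj := weight_gt0 gamma j0.
set a := (w i)^-1; set b := (w j)^-1; set W := lead i j; set s := spread i j.
have a0 : 0 < a by rewrite invr_gt0.
have b0 : 0 < b by rewrite invr_gt0.
have -> : w i * (energy2 i.+1 j - energy2 i j) + w j * (energy2 i j.+1 - energy2 i j)
  = a * (4 * W ^+ 2 - c * (W ^+ 2 + s) - 2 * c * W * a) +
    b * (4 * W ^+ 2 - c * (W ^+ 2 + s) - 2 * c * (- W) * b).
  rewrite /a /b /W /s /energy2 /energy /lead /spread !clockS !clock_varS; field.
  by rewrite !gt_eqF.
have Na : 4 * W ^+ 2 - c * (W ^+ 2 + s) - 2 * c * W * a <= 0.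
  exact/energy2_jump_neg/spread_jump.
have Nb : 4 * W ^+ 2 - c * (W ^+ 2 + s) - 2 * c * (- W) * b <= 0.
  rewrite -sqrrN; apply: energy2_jump_neg; rewrite /s spreadC; exact: spread_jump.
have := mulr_ge0_le0 (ltW a0) Na; have := mulr_ge0_le0 (ltW b0) Nb; lra.
Qed.

Lemma energy_le N i j : (N <= i)%N -> (N <= j)%N ->
  energy i j <= (clock_end - clock N) ^+ 2 + 2 * (clock_var_end - clock_var N).
Proof.
move=> Ni Nj; have := clock_var_nd Ni; have := clock_var_nd Nj => vj vi.
have := clock_nd Ni; have := clock_nd Nj => cj ci.
have := clock_le_end i; have := clock_le_end j => ej ei.
have L : lead i j ^+ 2 <= (clock_end - clock N) ^+ 2.
  by rewrite -ler_sqrt ?sqr_ge0// !sqrtr_sqr ler_norml /lead ger0_norm; lra.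
by rewrite /energy /spread; lra.
Qed.

Variables x y : nat.
Hypothesis xy : x != y.

Let both (N : nat) (g : graph) : Prop := (N < deg g x)%N /\ (N < deg g y)%N.

Let both_born n g : grown n g -> both 0 g -> (x < nvertices g)%N /\ (y < nvertices g)%N.
Proof.
move=> hg [xg yg]; split; rewrite ltnNge.
  by apply: contraTN xg => /(deg_unborn hg) ->.
by apply: contraTN yg => /(deg_unborn hg) ->.
Qed.

Let both_attach N n g z : grown n g -> (z < nvertices g)%N -> both N g ->
  both N (attach g z).
Proof.
move=> hg zlt [xg yg]; split; rewrite deg_attach//.
  exact: leq_trans xg (leq_addl _ _).
exact: leq_trans yg (leq_addl _ _).
Qed.

(** The combination of [energy] and [energy2] used for a second-moment
    (Paley-Zygmund) bound, relative to a reference value [e0] of the energy. *)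
Let score (e0 : R) (g : graph) : R :=
  2 * energy (deg g x) (deg g y) / e0 - energy2 (deg g x) (deg g y) / (K * e0 ^+ 2).

Let K_gt0 : 0 < K. Proof. by rewrite /K /c; have := q4_gt0; lra. Qed.

Lemma score_submartingale e0 : 0 < e0 -> forall n g, grown n g -> both 0 g ->
  score e0 g <= next_mean w (score e0) g.
Proof.
move=> e00 n g hg bg; have [xlt ylt] := both_born hg bg; have [i0 j0] := bg.
set i := deg g x in i0; set j := deg g y in j0.
pose U i j := 2 * energy i j / e0 - energy2 i j / (K * e0 ^+ 2).
have S0 := total_weight_gt0 (@weight_gt0 R gamma) hg.
have := @next_mean_le R gamma n g (fun g => - score e0 g) (- U i j)
  (U i j - U i.+1 j) (U i j - U i j.+1) x y hg xlt ylt.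
have -> : next_mean w (fun g => - score e0 g) g = - next_mean w (score e0) g.
  by rewrite /next_mean -sumrN; apply: eq_bigr => z _; rewrite mulrN.
have H z : (z < nvertices g)%N -> - score e0 (attach g z) <=
    - U i j + (z == x)%:R * (U i j - U i.+1 j) + (z == y)%:R * (U i j - U i j.+1).
  move=> zlt; rewrite /score !deg_attach_old// -/i -/j.
  have [->|zx] := eqVneq z x.
    by rewrite (negbTE xy) eq_sym (negbTE xy) addn0 addn1 mul1r mul0r /U; lra.
  have [_|zy] := eqVneq z y.
    by rewrite addn0 addn1 mul1r mul0r /U; lra.
  by rewrite !addn0 !mul0r /U; lra.
move=> /(_ H) {H}; have dr : 0 <= w i * (U i.+1 j - U i j) + w j * (U i j.+1 - U i j).
  have Ke : 0 < K * e0 ^+ 2 by rewrite mulr_gt0 ?exprn_gt0.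
  have -> : w i * (U i.+1 j - U i j) + w j * (U i j.+1 - U i j) =
    2 / e0 * (w i * (energy i.+1 j - energy i j) + w j * (energy i j.+1 - energy i j))
    - (w i * (energy2 i.+1 j - energy2 i j) + w j * (energy2 i j.+1 - energy2 i j))
      / (K * e0 ^+ 2).
    by rewrite /U; ring.
  rewrite energy_drift// mulr0 sub0r -mulNr divr_ge0 ?(ltW Ke)// oppr_ge0.
  exact: energy2_drift.
rewrite /target_prob -/i -/j => le.
have : 0 <= (w i * (U i.+1 j - U i j) + w j * (U i j.+1 - U i j)) / total_weight w g.
  by rewrite divr_ge0// ltW.
have -> : score e0 g = U i j by [].
lra.
Qed.

Lemma score_start g : both 0 g -> 1 <= score (energy (deg g x) (deg g y)) g.
Proof.
move=> [i0 j0]; rewrite /score; set i := deg g x in i0 *; set j := deg g y in j0 *.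
have Y0 := energy_gt0 j i0; set Y := energy i j in Y0 *.
have KY : 0 < K * Y ^+ 2 by rewrite mulr_gt0 ?exprn_gt0 ?K_gt0.
rewrite mulfK ?gt_eqF// lerBrDr -lerBrDl ler_pdivrMr//.
have sY : spread i j <= Y by rewrite /Y lerDr sqr_ge0.
have c0 : 0 < c by rewrite /c; have := q4_gt0; lra.
have : c * Y * spread i j <= c * Y * Y by rewrite ler_wpM2l// ltW// mulr_gt0.
by rewrite /energy2 -/Y /K; lra.
Qed.

Lemma score_le_energy e0 g : 0 < e0 -> both 0 g ->
  score e0 g <= 2 * energy (deg g x) (deg g y) / e0.
Proof.
move=> e00 [i0 j0]; rewrite /score gerBl divr_ge0//.
  have c0 : 0 < c by rewrite /c; have := q4_gt0; lra.
  have Y0 := energy_gt0 (deg g y) i0.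
  by rewrite addr_ge0 ?sqr_ge0// !mulr_ge0 ?(ltW c0) ?(ltW Y0)// ltW ?spread_gt0.
by rewrite mulr_ge0 ?sqr_ge0 ?(ltW K_gt0).
Qed.

Lemma score_le e0 g : 0 < e0 -> both 0 g -> score e0 g <= K.
Proof.
move=> e00 [i0 j0]; rewrite /score; set Y := energy _ _; set Q := energy2 _ _.
have Y0 : 0 < Y by exact: energy_gt0.
have c0 : 0 < c by rewrite /c; have := q4_gt0; lra.
have QY : Y ^+ 2 <= Q.
  by rewrite lerDl !mulr_ge0 ?(ltW c0) ?(ltW Y0)// ltW ?spread_gt0.
have Ke : 0 < K * e0 ^+ 2 by rewrite mulr_gt0 ?exprn_gt0 ?K_gt0.
have : Y ^+ 2 / (K * e0 ^+ 2) <= Q / (K * e0 ^+ 2).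
  by rewrite ler_wpM2r// invr_ge0 ltW.
have : 0 <= (Y / e0 - K) ^+ 2 / K by rewrite divr_ge0 ?sqr_ge0 ?(ltW K_gt0).
have -> : (Y / e0 - K) ^+ 2 / K = Y ^+ 2 / (K * e0 ^+ 2) - 2 * Y / e0 + K.
  by field; rewrite !gt_eqF ?K_gt0.
lra.
Qed.

(** Paley-Zygmund: the energy keeps its mean while its second moment stays
    bounded, so it stays away from zero with probability at least [1 / K],
    whatever the tree at time [n]. *)
Lemma escape_prob n g : grown n g -> both 0 g ->
  prob P ([set t | G n t = g] `&`
    [set t | forall N, exists2 n, (0 < n)%N & both N (G n t)]) <=
  (1 - K^-1) * prob P [set t | G n t = g].
Proof.
move=> hg bg; have n0 := grown_gt0 hg; have [i0 j0] := bg; have Kp := K_gt0.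
set A := [set t | forall N, _]; set p := prob P [set t | G n t = g].
set e0 := energy (deg g x) (deg g y).
have e00 : 0 < e0 by exact: energy_gt0.
pose eps N := (clock_end - clock N) ^+ 2 + 2 * (clock_var_end - clock_var N).
have eps0 N : 0 <= eps N.
  by rewrite addr_ge0 ?sqr_ge0// mulr_ge0// subr_ge0 clock_var_le_end.
have p0 : 0 <= p by exact: prob_ge0.
have mg : measurable [set t | G n t = g] by exact: (pa_measurable hG).
have mB N m : (0 < m)%N -> measurable [set t | both N (G m t)].
  by move=> m0; exact: (measurable_G hG (fun g => both N g)).
(* If both degrees exceed [N] at time [n + m], the energy is at most [eps N]. *)
have stay N m : prob P ([set t | G n t = g] `&` [set t | both N (G (n + m) t)]) <=
    (1 - (1 - 2 * eps N / e0) / K) * p.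
  have nm0 : (0 < n + m)%N by rewrite (leq_trans n0)// leq_addr.
  have H := @submartingale_escape _ _ _ _ w G hG (both 0) (both N) (score e0)
    (2 * eps N / e0) K _ (score_submartingale e00) _ _ (ltW Kp) m n g hg bg.
  have {H} : p * score e0 g <= 2 * eps N / e0 * p +
      K * prob P ([set t | G n t = g] `&` [set t | ~ both N (G (n + m) t)]).
    apply: H => [n' g' z hg' zlt|n' g' hg' bg'|n' g' hg' bg' [xN yN]].
    - exact: both_attach hg' zlt.
    - by rewrite ler_wpDl ?score_le// divr_ge0 ?mulr_ge0// ltW.
    - rewrite (le_trans (score_le_energy e00 bg'))// ler_wpM2r ?invr_ge0 ?(ltW e00)//.
      by rewrite ler_wpM2l// energy_le// ltnW.
  have := ler_wpM2l p0 (score_start bg); rewrite -/e0 mulr1 => h1 h2.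
  have := prob_setD P mg (mB N _ nm0); rewrite -/p.
  rewrite (_ : ~` _ = [set t | ~ both N (G (n + m) t)])//.
  set r := prob P _; set s := prob P _ in h2 * => pE.
  have -> : r = p - s by rewrite pE addrK.
  rewrite mulrBl mul1r lerD2l lerN2 mulrAC ler_pdivrMr// mulrC mulrBr mulr1.
  by rewrite [s * _]mulrC; lra.
have key N : prob P ([set t | G n t = g] `&` A) <=
    (1 - (1 - 2 * eps N / e0) / K) * p.
  apply: (@le_trans _ _ (prob P (\bigcup_m
      ([set t | G n t = g] `&` [set t | both N (G (n + m) t)])))).
    apply: le_prob.
    - apply: measurableI => //.
      apply: measurable_forall => [|N']; first exact: countableP.
      rewrite (_ : [set t | _] = [set t | exists n, (0 < n)%N /\ both N' (G n t)]).
        apply: measurable_exists => [|m]; first exact: countableP.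
        have [m0|m0] := posnP m; last first.
          by apply: measurable_conj; [exact: measurable_const|exact: mB].
        by rewrite (_ : [set t | _] = set0)//; apply/seteqP; split=> t //= []; rewrite m0.
      by apply/seteqP; split=> t /= => [[m]|[m []]]; exists m.
    - apply: bigcupT_measurable => m; apply: measurableI => //; apply: mB.
      by rewrite (leq_trans n0)// leq_addr.
    - move=> t /= [tg /(_ N) [m m0 bm]]; exists m => //; split=> //=.
      have grow k : both N (G (m + k) t).
        elim: k => [|k IH]; rewrite ?addn0// addnS.
        have mk0 : (0 < m + k)%N by rewrite (leq_trans m0)// leq_addr.
        have [z zlt ->] := G_step hG t mk0.
        exact: both_attach (G_grown hG t mk0) zlt IH.
      by rewrite addnC; exact: grow.
  apply: prob_bigcup_le => [m|m1 m2 m12|//].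
    by apply: measurableI => //; apply: mB; rewrite (leq_trans n0)// leq_addr.
  apply/subsetPset => t /= [tg b1]; split=> //.
  rewrite -(subnKC m12) addnA; elim: (m2 - m1)%N => [|k IH]; rewrite ?addn0// addnS.
  have k0 : (0 < n + m1 + k)%N by lia.
  have [z zlt ->] := G_step hG t k0.
  exact: both_attach (G_grown hG t k0) zlt IH.
have eps_cvg : (fun N => (1 - (1 - 2 * eps N / e0) / K) * p) @ \oo -->
    (1 - (1 - 2 * ((clock_end - clock_end) ^+ 2 + 2 * (clock_var_end - clock_var_end))
      / e0) / K) * p.
  apply: cvgM; last exact: cvg_cst.
  apply: cvgB; first exact: cvg_cst.
  apply: cvgM; last exact: cvg_cst.
  apply: cvgB; first exact: cvg_cst.
  apply: cvgM; last exact: cvg_cst.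
  apply: cvgM; first exact: cvg_cst.
  apply: cvgD.
    rewrite expr2; apply: cvgM; (apply: cvgB; first exact: cvg_cst); exact: clock_cvg.
  apply: cvgM; first exact: cvg_cst.
  by apply: cvgB; first exact: cvg_cst; exact: clock_var_cvg.
rewrite !subrr expr0n /= !mulr0 addr0 mulr0 mul0r subr0 mul1r in eps_cvg.
rewrite -(cvg_lim _ eps_cvg)//; apply: limr_ge.
  by apply/cvg_ex; eexists; exact: eps_cvg.
by apply: nearW => N; exact: key.
Qed.

(** The bound of [escape_prob] holds at all times, so the zero-one law applies. *)
Lemma at_most_one_unbounded : {ae P, forall t, ~ forall N, exists2 n,
  (0 < n)%N & (N < deg (G n t) x)%N /\ (N < deg (G n t) y)%N}.
Proof.
have K1 : 1 < K by rewrite /K /c; have := q4_gt0; lra.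
apply: (@zero_one _ _ _ P w G hG both (1 - K^-1)).
- by rewrite subr_ge0 invf_le1 ?K_gt0// ltW.
- by rewrite gtrBl invr_gt0 K_gt0.
- by move=> N n g z hg zlt; exact: both_attach hg zlt.
- by move=> N g [xN yN]; split; exact: ltnW.
- by move=> n g hg bg; exact: escape_prob.
Qed.

End race.

(** * Typical trajectories *)

Section typical.
Variables (R : realType) (gamma : R).
Hypothesis gamma1 : 1 < gamma.

Local Notation w := (weight gamma).
Local Notation delta := (gamma - 1).

(** The almost sure properties from which everything else follows
    deterministically. *)
Record typical (p : nat -> graph) : Prop := Typical {
  typical_grown : forall n, (0 < n)%N -> grown n (p n);
  typical_step : forall n, (0 < n)%N ->
    exists2 x, (x < nvertices (p n))%N & p n.+1 = attach (p n) x;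
  typical_growth : exists2 K : R, 0 < K &
    forall n, (0 < n)%N -> n%:R <= K * (Vmax (p n))%:R ^+ 4;
  typical_few : exists k, exists K : R,
    forall n, (0 < n)%N -> (Phi k (p n))%:R <= K;
  typical_race : forall x y, x != y -> ~ forall N, exists2 n, (0 < n)%N &
    (N < deg (p n) x)%N /\ (N < deg (p n) y)%N;
  typical_Vmax : tracks (fun n => (Vmax (p n))%:R : R)
    (psum (fun i => hit_prob w (fun g x => deg g x == Vmax g) (p i)));
  typical_Phi : forall k, (0 < k)%N -> tracks (fun n => (Phi k.+1 (p n))%:R : R)
    (psum (fun i => hit_prob w (fun g x => deg g x == k) (p i))) }.

Lemma typical_ae d (T : measurableType d) (P : probability T R)
    (G : nat -> T -> graph) : preferential_attachment P w G ->
  {ae P, forall t, typical (G ^~ t)}.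
Proof.
move=> hG; have w0 := @weight_gt0 R gamma.
have [k few] := Phi_bounded_ae gamma1 hG.
have /ae_foralln race : forall x, {ae P, forall t, forall y, x != y ->
    ~ forall N, exists2 n, (0 < n)%N & (N < deg (G n t) x)%N /\ (N < deg (G n t) y)%N}.
  move=> x; apply: ae_foralln => y; have [xy|xy] := boolP (x != y).
    by apply: filterS (at_most_one_unbounded gamma1 hG xy).
  exact: aeW.
have tV : {ae P, forall t, tracks (fun n => (Vmax (G n t))%:R : R)
    (psum (fun i => hit_prob w (fun g x => deg g x == Vmax g) (G i t)))}.
  apply: (count_tracks w0 hG (f := fun g => (Vmax g)%:R)
    (A := fun g x => deg g x == Vmax g)) => n g x hg xlt.
  rewrite (Vmax_attach hg)// -natrD; congr (_%:R).
  by have := deg_le_Vmax xlt; case: eqP => [->|ne] dle; lia.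
have /ae_foralln tP : forall k, {ae P, forall t, (0 < k)%N ->
    tracks (fun n => (Phi k.+1 (G n t))%:R : R)
    (psum (fun i => hit_prob w (fun g x => deg g x == k) (G i t)))}.
  move=> k'; have [k0|k0] := posnP k'; first exact: aeW.
  have := count_tracks w0 hG (f := fun g => (Phi k'.+1 g)%:R)
    (A := fun g x => deg g x == k').
  move=> H; apply: filterS (H _) => // n g x hg xlt.
  by rewrite -natrD (Phi_attach _ hg).
apply: filterS3 (Vmax_growth gamma1 hG) few (filterI race (filterI tV tP)).
move=> t g1 g2 [g3 [g4 g5]]; split=> //.
- by move=> n n0; exact: (G_grown hG t n0).
- by move=> n n0; exact: (G_step hG t n0).
- by exists k.
Qed.

Variable p : nat -> graph.
Hypothesis hp : typical p.

Local Notation S n := (total_weight w (p n)).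
Local Notation M n := (Vmax (p n)).

Let pg := typical_grown hp.

Lemma typical_persist (f : graph -> nat) :
  (forall n g x, grown n g -> (x < nvertices g)%N -> (f g <= f (attach g x))%N) ->
  forall m n, (0 < m)%N -> (m <= n)%N -> (f (p m) <= f (p n))%N.
Proof.
move=> fA m n m0 /subnKC <-; elim: (n - m)%N => [|k IH]; first by rewrite addn0.
have mk0 : (0 < m + k)%N by rewrite (leq_trans m0)// leq_addr.
rewrite addnS; have [x xlt ->] := typical_step hp mk0.
apply: leq_trans IH _; exact: fA (pg mk0) xlt.
Qed.

Lemma deg_persist u m n : (0 < m)%N -> (m <= n)%N -> (deg (p m) u <= deg (p n) u)%N.
Proof.
move=> m0 mn; apply: (typical_persist (f := fun g => deg g u)) => // i g x hg xlt.
by rewrite deg_attach// leq_addl.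
Qed.

Lemma Phi_persist k m n : (0 < m)%N -> (m <= n)%N -> (Phi k (p m) <= Phi k (p n))%N.
Proof.
move=> m0 mn; apply: (typical_persist (f := fun g => Phi k g)) => // i g x hg xlt.
rewrite !PhiE {2}/nvertices /= -/(nvertices g) big_ord_recr/=.
apply: leq_trans (leq_addr _ _); apply: leq_sum => y _.
by rewrite deg_attach_old//; case: (leqP k (deg g y)) => // kd; rewrite (leq_trans kd)// leq_addr.
Qed.

Lemma hit_deg k n : (0 < n)%N ->
  hit_prob w (fun g x => deg g x == k) (p n) = w k * (Zdeg k (p n))%:R / S n.
Proof.
move=> n0; rewrite /hit_prob /target_prob ZdegE natr_sum mulr_sumr mulr_suml big_mkcond/=.
apply: eq_bigr => x _; case: eqP => [->|_]; first by rewrite mulr1.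
by rewrite mulr0 mul0r.
Qed.

Lemma hit_Vmax n : (0 < n)%N ->
  w (M n) / S n <= hit_prob w (fun g x => deg g x == Vmax g) (p n).
Proof.
move=> n0; have [h hlt dh] := Vmax_attained (pg n0).
rewrite /hit_prob (bigD1 (Ordinal hlt))/= ?dh//; rewrite {1}/target_prob dh lerDl.
by apply: sumr_ge0 => x _; exact: (target_prob_ge0 (@weight_gt0 R gamma) (pg n0)).
Qed.

Lemma total_weight_pos n : (0 < n)%N -> 0 < S n.
Proof. by move=> n0; exact: (total_weight_gt0 (@weight_gt0 R gamma) (pg n0)). Qed.

Lemma Vmax_ge1 n : (0 < n)%N -> 1 <= (M n)%:R :> R.
Proof. by move=> n0; rewrite ler1n; exact: Vmax_gt0 (pg n0). Qed.

Lemma w_ge0 k : 0 <= w k.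
Proof. exact: powR_ge0. Qed.

(** Outside the few vertices of large degree, the weights add up to [O(n)]. *)
Lemma total_weight_le_few : exists2 C : R, 0 < C & forall n, (0 < n)%N ->
  S n <= C * (n%:R + w (M n)).
Proof.
have [k [K HK]] := typical_few hp.
exists (2 * w k + `|K| + 1); first by have := w_ge0 k; have := normr_ge0 K; lra.
move=> n n0; have n1 : 1 <= n%:R :> R by rewrite ler1n.
apply: (@le_trans _ _ (n.+1%:R * w k + (Phi k (p n))%:R * w (M n))).
  rewrite -(grown_nvertices (pg n0)) PhiE natr_sum mulr_suml.
  have -> : (nvertices (p n))%:R * w k = \sum_(x < nvertices (p n)) w k.
    by rewrite mulr_natl sumr_const card_ord.
  rewrite -big_split; apply: ler_sum => x _ /=; case: leqP => kd.
    rewrite mul1r ler_wpDl ?w_ge0//; apply: (weight_homo gamma1).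
    exact: deg_le_Vmax.
  by rewrite mul0r addr0; apply: (weight_homo gamma1); exact: ltnW.
have := HK n n0 => /(ler_wpM2r (w_ge0 (M n))).
have := ler_wpM2r (w_ge0 (M n)) (ler_norm K).
have := ler_wpM2r (w_ge0 k) n1; rewrite -natr1.
have := mulr_ge0 (w_ge0 k) (w_ge0 (M n)).
have := mulr_ge0 (normr_ge0 K) (le_trans ler01 n1).
have := w_ge0 (M n).
nra.
Qed.

(** If [Vmax] grows at least like [n `^ al], the maximal degree is hit with
    probability at least of order [n `^ (al * gamma - 1)] as long as this exponent is
    negative, and summation improves [al] by the factor [gamma]. *)
Lemma growth_bootstrap al : 0 < al ->
  (exists2 c : R, 0 < c & forall n, (0 < n)%N -> c * n%:R `^ al <= (M n)%:R) ->
  exists2 c : R, 0 < c & forall n, (0 < n)%N ->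
    c * n%:R `^ (Num.min (al * gamma) 1) <= (M n)%:R.
Proof.
move=> al0 [c c0 Hc]; have [C C0 HC] := total_weight_le_few.
set be := Num.min (al * gamma) 1.
have be1 : be <= 1 by rewrite ge_min lexx orbT.
have g0 : 0 <= gamma by rewrite (le_trans ler01) ?(ltW gamma1).
pose cg := c `^ gamma; have cg0 : 0 < cg by exact: powR_gt0.
have be0 : 0 < be by rewrite lt_min ltr01 mulr_gt0// (lt_trans ltr01).
(* The weight of the maximal degree is at least [cg * i `^ be], and
   [u / (C * (i + u))] increases with [u]. *)
pose c1 := cg / (C * (1 + cg)).
have c10 : 0 < c1 by rewrite divr_gt0// mulr_gt0// addr_gt0.
have q_ge i : (0 < i)%N -> c1 * i%:R `^ (be - 1) <=
    hit_prob w (fun g x => deg g x == Vmax g) (p i).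
  move=> i0; apply: le_trans (hit_Vmax i0).
  have ip : 0 < i%:R :> R by rewrite ltr0n.
  have i1 : 1 <= i%:R :> R by rewrite ler1n.
  have u_ge : cg * i%:R `^ be <= w (M i).
    apply: (@le_trans _ _ ((c * i%:R `^ al) `^ gamma)).
      rewrite powRM ?powR_ge0 ?(ltW c0)// -powRrM ler_wpM2l ?(ltW cg0)//.
      by rewrite ler_powR// ge_min lexx.
    by rewrite ge0_ler_powR ?nnegrE ?mulr_ge0 ?powR_ge0 ?(ltW c0) ?Hc.
  have ib : i%:R `^ be <= i%:R by rewrite -[leRHS]powRr1 ?(ltW ip)// ler_powR.
  have u0 : 0 < w (M i) by apply: lt_le_trans u_ge; rewrite mulr_gt0// powR_gt0.
  have Si := total_weight_pos i0.
  rewrite ler_pdivlMr//.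
  apply: (@le_trans _ _ (c1 * i%:R `^ (be - 1) * (C * (i%:R + w (M i))))).
    by rewrite ler_wpM2l ?HC// mulr_ge0 ?powR_ge0// ltW.
  have -> : i%:R `^ (be - 1) = i%:R `^ be / i%:R.
    rewrite powRB; first by rewrite powRr1// ltW.
    by rewrite [_%:R == 0]gt_eqF// implybT.
  have -> : c1 * (i%:R `^ be / i%:R) * (C * (i%:R + w (M i))) =
      (cg * i%:R `^ be) * (1 + w (M i) / i%:R) / (1 + cg).
    by rewrite /c1; field; rewrite !gt_eqF// addr_gt0.
  rewrite ler_pdivrMr ?addr_gt0// mulrDr mulr1.
  have : cg * i%:R `^ be * (w (M i) / i%:R) <= cg * w (M i).
    rewrite -mulrA ler_wpM2l ?(ltW cg0)// mulrCA ger_pMr//.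
    by rewrite ler_pdivrMr// mul1r.
  by rewrite mulrDr mulr1 [w (M i) * cg]mulrC; lra.
have h2 : 0 < 2^-1 :> R by rewrite invr_gt0.
have [K HK] := typical_Vmax hp h2.
have D0 : 0 < 1 + c1 / 2 + `|K| by rewrite ltr_wpDr// addr_gt0// divr_gt0.
exists (c1 / 2 / (1 + c1 / 2 + `|K|)).
  by rewrite divr_gt0// divr_gt0.
move=> n n0; have np : 0 < n%:R :> R by rewrite ltr0n.
have n1 : 1 <= n%:R :> R by rewrite ler1n.
set B := psum _ in HK.
have Bn : c1 * (n%:R `^ be - 1) <= B n.
  apply: (@le_trans _ _ (psum (fun=> c1 * n%:R `^ (be - 1)) n)).
    rewrite /psum sumr_const_nat -[leRHS]mulr_natr natrB// -mulrA ler_wpM2l ?(ltW c10)//.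
    rewrite mulrBr mulr1; apply: lerB.
      by rewrite mulrC mulr_powRB1 ?(ltW np)// be0.
    by rewrite -[leRHS](powRr0 n%:R) ler_powR// subr_le0.
  apply: ler_sum_nat => i /andP[i0 iltn]; apply: le_trans (q_ge i i0).
  rewrite ler_wpM2l ?(ltW c10)//.
  have -> : be - 1 = - (1 - be) by rewrite opprB.
  rewrite !powRN lef_pV2 ?posrE ?powR_gt0 ?ltr0n// ge0_ler_powR ?nnegrE ?subr_ge0//.
  by rewrite ler_nat ltnW.
have M1 := Vmax_ge1 n0.
have : c1 / 2 * n%:R `^ be <= (M n)%:R + c1 / 2 + `|K|.
  have := HK n n0; have := ler_norm K; rewrite ler_norml => hK /andP[h _].
  lra.
move=> h3; rewrite [leLHS]mulrAC ler_pdivrMr// mulrDr mulrDr mulr1.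
have : c1 / 2 <= (M n)%:R * (c1 / 2) by rewrite ler_peMl// divr_ge0// ltW.
have : `|K| <= (M n)%:R * `|K| by rewrite ler_peMl.
lra.
Qed.

Lemma Vmax_linear : exists2 c : R, 0 < c & forall n, (0 < n)%N -> c * n%:R <= (M n)%:R.
Proof.
have H j : exists2 c : R, 0 < c & forall n, (0 < n)%N ->
    c * n%:R `^ (Num.min (gamma ^+ j / 4) 1) <= (M n)%:R.
  elim: j => [|j /growth_bootstrap IH].
    have [K K0 HK] := typical_growth hp.
    have Kp : 0 < K `^ (1 / 4) by exact: powR_gt0.
    exists (K `^ (1 / 4))^-1; first by rewrite invr_gt0.
    move=> n n0; rewrite mulrC ler_pdivrMr// expr0 min_l; last lra.
    have -> : (M n)%:R * K `^ (1 / 4) = (K * (M n)%:R ^+ 4) `^ (1 / 4).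
      rewrite powRM ?(ltW K0) ?exprn_ge0// -powR_mulrn// -powRrM mulrC.
      have e1 : 4 * (1 / 4) = 1 :> R by field.
      by rewrite e1 powRr1.
    by rewrite ge0_ler_powR ?nnegrE ?HK// mulr_ge0 ?exprn_ge0// ltW.
  have m0 : 0 < Num.min (gamma ^+ j / 4) 1.
    by rewrite lt_min ltr01 andbT divr_gt0 ?exprn_gt0// (lt_trans ltr01).
  have [c c0 Hc] := IH m0; exists c => //.
  suff <- : Num.min (Num.min (gamma ^+ j / 4) 1 * gamma) 1 = Num.min (gamma ^+ j.+1 / 4) 1.
    exact: Hc.
  have -> : gamma ^+ j.+1 / 4 = gamma ^+ j / 4 * gamma by rewrite exprSr mulrAC.
  have [h|h] := leP (gamma ^+ j / 4) 1; first by [].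
  rewrite mul1r !min_r ?(ltW gamma1)//; have := gamma1; nra.
have [j jE] : exists j, 4 <= gamma ^+ j.
  pose j := (Num.truncn (4 / delta)).+1; exists j.
  have d0 : 0 < delta by rewrite subr_gt0.
  have : 4 <= j%:R * delta by rewrite -ler_pdivrMr//; exact/ltW/truncnS_gt.
  have Bern i : 1 + i%:R * delta <= gamma ^+ i.
    elim: i => [|i IH]; first by rewrite mul0r addr0 expr0.
    rewrite exprSr -natr1; have := ler_wpM2r (ltW (lt_trans ltr01 gamma1)) IH.
    have : 0 <= i%:R * delta * delta by rewrite !mulr_ge0// ltW.
    lra.
  by have := Bern j; lra.
have [c c0 Hc] := H j; exists c => // n n0.
have := Hc n n0; rewrite min_r ?powRr1//.
by rewrite ler_pdivlMr// mul1r.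
Qed.

End typical.

(** * The hub *)

Section hub.
Variables (R : realType) (gamma : R) (p : nat -> graph).
Hypothesis gamma1 : 1 < gamma.
Hypothesis hp : typical gamma p.

Local Notation w := (weight gamma).
Local Notation delta := (gamma - 1).
Local Notation S n := (total_weight w (p n)).
Local Notation M n := (Vmax (p n)).

Let pg := typical_grown hp.

Definition unbounded_deg v := forall N, exists2 n, (0 < n)%N & (N < deg (p n) v)%N.

Lemma bounded_monotone_nat (f : nat -> nat) (K : R) :
  (forall m n, (0 < m)%N -> (m <= n)%N -> (f m <= f n)%N) ->
  (forall n, (0 < n)%N -> (f n)%:R <= K) ->
  exists2 m, (0 < m)%N & forall n, (m <= n)%N -> f n = f m.
Proof.
move=> fnd fK; pose B := Num.truncn K.
have fB n : (0 < n)%N -> (f n <= B)%N.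
  by move=> n0; rewrite truncn_ge_nat ?fK// (le_trans _ (fK n n0)).
suff H k m : (0 < m)%N -> (B - f m <= k)%N ->
    exists2 m, (0 < m)%N & forall n, (m <= n)%N -> f n = f m by exact: (H B 1%N isT (leq_subr _ _)).
elim: k m => [|k IH] m m0 mk.
  exists m => // n mn; have := fnd m n m0 mn; have := fB n (leq_trans m0 mn); lia.
have [[n mn fmn]|nf] := pselect (exists2 n, (m <= n)%N & (f m < f n)%N).
  by apply: (IH n); [exact: leq_trans mn|have := fB n (leq_trans m0 mn); lia].
exists m => // n mn; apply/eqP; rewrite eqn_leq (fnd m n m0 mn) andbT leqNgt.
by apply/negP => fmn; apply: nf; exists n.
Qed.

Lemma Phi_stable k (K : R) : (forall n, (0 < n)%N -> (Phi k (p n))%:R <= K) ->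
  exists2 m, (0 < m)%N & forall n, (m <= n)%N -> Phi k (p n) = Phi k (p m).
Proof.
apply: bounded_monotone_nat => m n m0 mn; exact: (Phi_persist hp).
Qed.

(** Once the number of vertices of degree at least [k] has stabilised, no later
    vertex ever reaches degree [k]. *)
Lemma late_small_deg : exists k m, forall n u, (0 < n)%N -> (m < u)%N ->
  (deg (p n) u < k)%N.
Proof.
have [k [K /Phi_stable [m m0 HM]]] := typical_few hp.
exists k.+1, m => n u n0 mu; rewrite ltnS.
apply: leq_trans (deg_persist hp u n0 (leq_maxl n m)) _.
set N := maxn n m; have mN : (m <= N)%N by exact: leq_maxr.
have N0 : (0 < N)%N by exact: leq_trans mN.
rewrite leqNgt; apply/negP => kN.
have uN : (u < nvertices (p N))%N.
  by rewrite ltnNge; apply: contraTN kN => /(deg_unborn (pg N0)) ->.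
have := HM N mN; apply/eqP; rewrite gtn_eqF// !PhiE.
have vm : (nvertices (p m) <= nvertices (p N))%N.
  by rewrite (grown_nvertices (pg m0)) (grown_nvertices (pg N0)) ltnS.
rewrite -(big_mkord predT (fun x => (k <= deg (p N) x : nat)%N)).
rewrite (big_cat_nat (n := nvertices (p m)))//=.
rewrite -(big_mkord predT (fun x => (k <= deg (p m) x : nat)%N)) -addn1 leq_add//.
  apply: leq_sum => x _; case: (leqP k (deg (p m) x)) => // h.
  by rewrite (leq_trans h)// (deg_persist hp).
rewrite (big_cat_nat (n := u)) ?(ltnW uN)//=; last first.
  by rewrite (grown_nvertices (pg m0)).
by rewrite [X in (_ + X)%N]big_ltn// (ltnW kN) addnCA leq_addr.
Qed.

Lemma uniform_bound (I : nat -> Prop) m :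
  (forall v, I v -> exists B, forall n, (0 < n)%N -> (deg (p n) v <= B)%N) ->
  exists B, forall v n, (v < m)%N -> I v -> (0 < n)%N -> (deg (p n) v <= B)%N.
Proof.
move=> HI; elim: m => [|m [B HB]]; first by exists 0%N.
have [Im|nIm] := pselect (I m).
  have [B' HB'] := HI m Im; exists (maxn B B') => v n; rewrite ltnS leq_eqVlt.
  move=> /orP[/eqP ->|vm] Iv n0; rewrite leq_max; first by rewrite HB' ?orbT.
  by rewrite (HB v n vm Iv n0) ?orbT.
exists B => v n; rewrite ltnS leq_eqVlt => /orP[/eqP ->//|vm]; exact: HB.
Qed.

Lemma bounded_deg v : ~ unbounded_deg v ->
  exists B, forall n, (0 < n)%N -> (deg (p n) v <= B)%N.
Proof.
move=> nb; apply: contrapT => nB; apply: nb => N; apply: contrapT => nN.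
apply: nB; exists N => n n0; rewrite leqNgt; apply/negP => h; apply: nN.
by exists n.
Qed.

Lemma bounded_but (I : nat -> Prop) : (forall v, I v -> ~ unbounded_deg v) ->
  exists C, forall v n, I v -> (0 < n)%N -> (deg (p n) v <= C)%N.
Proof.
move=> HI; have [k [m late]] := late_small_deg.
have [B HB] := @uniform_bound I m.+1 (fun v Iv => bounded_deg (HI v Iv)).
exists (maxn B k) => v n Iv n0; rewrite leq_max.
have [vm|mv] := leqP v m; first by rewrite HB.
by rewrite (ltnW (late n v n0 mv)) orbT.
Qed.

(** Otherwise [late_small_deg] would bound all degrees, against the linear growth
    of the maximal degree. *)
Lemma hub_exists : exists v, unbounded_deg v.
Proof.
apply: contrapT => nh.
have [C HC] := @bounded_but (fun=> True) (fun v _ bv => nh (ex_intro _ v bv)).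
have [c c0 Hc] := Vmax_linear gamma1 hp.
pose n := (Num.truncn (C%:R / c)).+1.
have := Hc n isT; have [x _ <-] := Vmax_attained (pg (isT : (0 < n)%N)).
apply/negP; rewrite -ltNge; apply: (@le_lt_trans _ _ C%:R).
  by rewrite ler_nat HC.
by rewrite mulrC -ltr_pdivrMr// truncnS_gt.
Qed.

Lemma hub_others v : unbounded_deg v ->
  exists C, forall u n, u <> v -> (0 < n)%N -> (deg (p n) u <= C)%N.
Proof.
move=> hv; apply: (@bounded_but (fun u => u <> v)) => u /eqP uv hu.
apply: (typical_race hp uv) => N; have [n n0 Nn] := hu N; have [m m0 Nm] := hv N.
exists (maxn n m); first by rewrite leq_max n0.
split; [apply: leq_trans Nn _|apply: leq_trans Nm _]; apply: (deg_persist hp) => //.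
  exact: leq_maxl.
exact: leq_maxr.
Qed.

Lemma hub_dominates v : unbounded_deg v -> exists n0, forall n, (0 < n)%N ->
  (n0 <= n)%N -> (v < nvertices (p n))%N /\ deg (p n) v = M n.
Proof.
move=> hv; have [C HC] := hub_others hv; have [n0 n00 Cn0] := hv C.
exists n0 => n n_gt0 n0n; have Cv := leq_trans Cn0 (deg_persist hp v n00 n0n).
have vn : (v < nvertices (p n))%N.
  by rewrite ltnNge; apply: contraTN Cv => /(deg_unborn (pg n_gt0)) ->.
split=> //; have [h hlt dh] := Vmax_attained (pg n_gt0).
have [<-//|hv'] := eqVneq h v; have := HC h n (fun e => negP hv' (introT eqP e)) n_gt0.
have := deg_le_Vmax vn; lia.
Qed.

(** All degrees but that of the hub are bounded, and there are [n + 1] vertices. *)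
Lemma total_weight_le_hub : exists2 C : R, 0 <= C & forall n, (0 < n)%N ->
  S n <= w (M n) + C * n%:R.
Proof.
have [v hv] := hub_exists; have [C HC] := hub_others hv.
exists (2 * w C); first by rewrite mulr_ge0 ?powR_ge0.
move=> n n0; have n1 : 1 <= n%:R :> R by rewrite ler1n.
have -> : S n = \sum_(x < nvertices (p n)) w (deg (p n) x) by [].
apply: (@le_trans _ _ (\sum_(x < nvertices (p n)) ((x == v :> nat)%:R * w (M n) + w C))).
  apply: ler_sum => x _; have [xv|xv] := eqVneq (x : nat) v.
    rewrite mul1r ler_wpDr ?powR_ge0//; apply: (weight_homo gamma1).
    exact: deg_le_Vmax.
  rewrite mul0r add0r; apply: (weight_homo gamma1); apply: HC => //; exact/eqP.
rewrite big_split/= sumr_const card_ord (grown_nvertices (pg n0)) -mulr_suml.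
apply: lerD.
  rewrite ler_piMl ?powR_ge0// -natr_sum lern1.
  have [vn|nv] := ltnP v n.+1; last first.
    by rewrite big1// => x _; rewrite ltn_eqF// (leq_trans (ltn_ord x) nv).
  rewrite (bigD1 (Ordinal vn))//= eqxx big1// => x xv.
  by apply/eqP; rewrite eqb0; apply: contra xv => /eqP ?; apply/eqP/val_inj.
rewrite -[leLHS]mulr_natr -natr1 mulrAC [leRHS]mulrC.
have : 0 <= w C by exact: powR_ge0.
nra.
Qed.

(** The weight of the hub is of order [n `^ gamma], the other weights add up to
    [O(n)], and [gamma > 1]. *)
Lemma hit_Vmax_cvg1 :
  (fun i => hit_prob w (fun g x => deg g x == Vmax g) (p i)) @ \oo --> (1 : R).
Proof.
have [C C0 HC] := total_weight_le_hub; have [c c0 Hc] := Vmax_linear gamma1 hp.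
have cg0 : 0 < c `^ gamma by exact: powR_gt0.
have lim1 : (fun n : nat => 1 - C / c `^ gamma * n%:R `^ (1 - gamma)) @ \oo --> (1 : R).
  rewrite -[X in _ --> X]subr0 -[X in _ --> _ - X](mulr0 (C / c `^ gamma)).
  apply: cvgB; first exact: cvg_cst.
  apply: cvgM; first exact: cvg_cst.
  by apply: powR_natr_cvg0; rewrite subr_lt0.
have one : (fun=> 1 : R) @ \oo --> (1 : R) by exact: cvg_cst.
apply: squeeze_cvgr lim1 one; near=> n; have n0 : (0 < n)%N by near: n; exact: nbhs_infty_gt.
have np : 0 < n%:R :> R by rewrite ltr0n.
have Sn : 0 < S n := total_weight_pos hp n0.
apply/andP; split; last first.
  rewrite -(sum_target_prob (@weight_gt0 R gamma) (pg n0)) /hit_prob big_mkcond/=.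
  apply: ler_sum => x _; case: ifP => // _.
  exact: (target_prob_ge0 (@weight_gt0 R gamma) (pg n0)).
apply: le_trans (hit_Vmax hp n0); rewrite ler_pdivlMr//.
have wM : c `^ gamma * n%:R `^ gamma <= w (M n).
  rewrite -powRM ?(ltW c0)// ge0_ler_powR ?nnegrE ?mulr_ge0 ?(ltW c0) ?Hc//.
  by rewrite (le_trans ler01) ?(ltW gamma1).
have MS : w (M n) <= S n.
  have [h hlt <-] := Vmax_attained (pg n0).
  exact: (weight_le_total (@weight_gt0 R gamma) (pg n0)).
have key : C * n%:R <= C / c `^ gamma * n%:R `^ (1 - gamma) * S n.
  rewrite -!mulrA ler_wpM2l// ler_pdivlMl//.
  have nE : n%:R = n%:R `^ (1 - gamma) * n%:R `^ gamma :> R.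
    rewrite -powRD ?subrK ?powRr1 ?(ltW np)//.
    by rewrite [_%:R == 0]gt_eqF// implybT.
  by rewrite {1}nE mulrCA ler_wpM2l ?powR_ge0// (le_trans wM).
have := HC n n0; lra.
Unshelve. all: by end_near. Qed.

Lemma Vmax_equiv : (fun n : nat => (n%:R : R)^-1 * (M n)%:R) @ \oo --> (1 : R).
Proof.
have q1 : (fun i => hit_prob w (fun g x => deg g x == Vmax g) (p i) / i%:R `^ (1 - 1))
    @ \oo --> (1 : R).
  rewrite subrr; under eq_fun do rewrite powRr0 invr1 mulr1.
  exact: hit_Vmax_cvg1.
have := tracks_powR (typical_Vmax hp) q1 ltr01; rewrite divr1.
by under eq_fun do rewrite powRr1 ?ler0n//.
Qed.

Lemma total_weight_equiv : (fun n : nat => S n / n%:R `^ gamma) @ \oo --> (1 : R).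
Proof.
have [C C0 HC] := total_weight_le_hub.
have Mg : (fun n : nat => ((n%:R)^-1 * (M n)%:R) `^ gamma : R) @ \oo --> (1 : R).
  have cont : {for (1 : R), continuous (fun x => x `^ gamma)}.
    apply: differentiable_continuous; apply/derivable1_diffP.
    exact: (@ex_derive _ _ _ _ _ _ _ (is_derive1_powR gamma (ltr01 : 0 < 1 :> R))).
  have e1 : (1 : R) `^ gamma = 1 by rewrite powR1.
  rewrite -[X in _ --> X]e1.
  exact: (continuous_cvg _ cont Vmax_equiv).
have up : (fun n : nat => ((n%:R)^-1 * (M n)%:R) `^ gamma + C * n%:R `^ (1 - gamma))
    @ \oo --> (1 : R).
  rewrite -[X in _ --> X]addr0; apply: cvgD => //.
  rewrite -[X in _ --> X](mulr0 C); apply: cvgM; first exact: cvg_cst.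
  by apply: powR_natr_cvg0; rewrite subr_lt0.
apply: squeeze_cvgr Mg up; near=> n; have n0 : (0 < n)%N by near: n; exact: nbhs_infty_gt.
have np : 0 < n%:R :> R by rewrite ltr0n.
have ng : 0 < n%:R `^ gamma :> R by exact: powR_gt0.
have -> : ((n%:R)^-1 * (M n)%:R) `^ gamma = w (M n) / n%:R `^ gamma :> R.
  by rewrite powRM ?invr_ge0// mulrC -[n%:R^-1]powR_inv1// powRAC powR_inv1// powR_ge0.
have MS : w (M n) <= S n.
  have [h hlt <-] := Vmax_attained (pg n0).
  exact: (weight_le_total (@weight_gt0 R gamma) (pg n0)).
apply/andP; split; first by rewrite ler_pM2r// invr_gt0.
rewrite ler_pdivrMr// mulrDl divfK ?gt_eqF// -mulrA -powRD.
  by rewrite subrK powRr1 ?(ltW np)// HC.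
by rewrite [_%:R == 0]gt_eqF// implybT.
Unshelve. all: by end_near. Qed.

End hub.

(** * Numbers of vertices of given degree *)

Section degree_counts.
Variables (R : realType) (gamma : R) (p : nat -> graph).
Hypothesis gamma1 : 1 < gamma.
Hypothesis hp : typical gamma p.

Local Notation w := (weight gamma).
Local Notation delta := (gamma - 1).
Local Notation S n := (total_weight w (p n)).

Let pg := typical_grown hp.

(** The exponent of [n] in the number of vertices of degree [k]. *)
Definition count_exponent (k : nat) : R := k%:R - (k%:R - 1) * gamma.

Local Notation ex := count_exponent.

Lemma count_exponentS k : ex k.+1 = ex k - delta.
Proof. by rewrite /ex -natr1; ring. Qed.

Lemma count_exponent1 : ex 1 = 1.
Proof. by rewrite /ex subrr mul0r subr0. Qed.

Let Phi_ n k : R := (Phi k (p n))%:R.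
Let Z_ n k : R := (Zdeg k (p n))%:R.
Let hit k i := hit_prob w (fun g x => deg g x == k) (p i).

Let ZE n k : Z_ n k = Phi_ n k - Phi_ n k.+1.
Proof. by rewrite /Z_ /Phi_ -(Zdeg_Phi k) natrD addrK. Qed.

Lemma total_weight_inv_equiv : (fun n : nat => n%:R `^ gamma / S n) @ \oo --> (1 : R).
Proof.
have h := cvgV (oner_neq0 _) (total_weight_equiv gamma1 hp); rewrite invr1 in h.
by apply: (cvg_trans _ (h _)); apply: near_eq_cvg; near=> n; rewrite /= invf_div.
Unshelve. all: by end_near. Qed.

(** The number of vertices of degree [k], scaled at the exponent [e + delta],
    determines the intensity of the hits scaled at the exponent [e - 1]. *)
Lemma hit_cvg k e a : (fun n : nat => (n%:R `^ (e + delta))^-1 * Z_ n k) @ \oo --> a ->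
  (fun i : nat => hit k i / i%:R `^ (e - 1)) @ \oo --> w k * a.
Proof.
move=> Za; have h := cvgM (cvg_cst (w k)) (cvgM Za total_weight_inv_equiv).
rewrite mulr1 in h; apply: (cvg_trans _ (h _ _ _)); apply: near_eq_cvg; near=> i => /=.
have i0 : (0 < i)%N by near: i; exact: nbhs_infty_gt.
have ip : 0 < i%:R :> R by rewrite ltr0n.
have Si : 0 < S i := total_weight_pos hp i0.
rewrite /hit hit_deg// -/(Z_ i k).
have -> : i%:R `^ gamma = i%:R `^ (e + delta) / i%:R `^ (e - 1) :> R.
  rewrite -powRB; first by congr (_ `^ _); ring.
  by rewrite [_%:R == 0]gt_eqF// implybT.
have p1 : 0 < i%:R `^ (e + delta) :> R by exact: powR_gt0.
have p2 : 0 < i%:R `^ (e - 1) :> R by exact: powR_gt0.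
by field; rewrite !gt_eqF.
Unshelve. all: by end_near. Qed.

Lemma Z_negligible k e : (fun n : nat => (n%:R `^ e)^-1 * Phi_ n k) @ \oo --> (0 : R) ->
  (fun n : nat => (n%:R `^ e)^-1 * Z_ n k) @ \oo --> (0 : R).
Proof.
move=> P0; have zero : (fun=> 0 : R) @ \oo --> (0 : R) by exact: cvg_cst.
apply: squeeze_cvgr zero P0; near=> n; rewrite mulr_ge0 ?invr_ge0 ?powR_ge0//=.
by rewrite ler_wpM2l ?invr_ge0 ?powR_ge0// ler_nat -(Zdeg_Phi k) leq_addr.
Unshelve. all: by end_near. Qed.

Lemma hit_negligible k e :
  (fun n : nat => (n%:R `^ (e + delta))^-1 * Phi_ n k) @ \oo --> (0 : R) ->
  (fun i : nat => hit k i / i%:R `^ (e - 1)) @ \oo --> (0 : R).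
Proof. by move=> /Z_negligible/hit_cvg; rewrite mulr0. Qed.

Let delta0 : 0 < delta. Proof. by rewrite subr_gt0. Qed.

Lemma Phi1_cvg e a : (fun n : nat => (n%:R `^ e)^-1 * n.+1%:R) @ \oo --> a ->
  (fun n : nat => (n%:R `^ e)^-1 * Phi_ n 1) @ \oo --> (a : R).
Proof.
move=> h; apply: (cvg_trans _ h); apply: near_eq_cvg; near=> n.
have n0 : (0 < n)%N by near: n; exact: nbhs_infty_gt.
by rewrite /Phi_ (Phi1 (pg n0)).
Unshelve. all: by end_near. Qed.

Let succ_over_powR e : (fun n : nat => (n%:R `^ e)^-1 * n.+1%:R : R) @ \oo
    `=>` (fun n : nat => n%:R `^ (1 - e) + n%:R `^ (- e)) @ \oo.
Proof.
apply: near_eq_cvg; near=> n.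
have n0 : (0 < n)%N by near: n; exact: nbhs_infty_gt.
have np : 0 < n%:R :> R by rewrite ltr0n.
rewrite -natr1 mulrDr mulr1 powRN powRB ?powRr1 ?(ltW np)//; last first.
  by rewrite [_%:R == 0]gt_eqF// implybT.
by rewrite mulrC.
Unshelve. all: by end_near. Qed.

(** The bound for [k] limits the intensity of the hits that feed [k.+1], which
    lowers the exponent by [delta]; the condition [0 < e] lets the induction pass
    beyond the logarithmic and bounded regimes. *)
Lemma Phi_negligible k e : ex k.+1 < e -> 0 < e ->
  (fun n : nat => (n%:R `^ e)^-1 * Phi_ n k.+1) @ \oo --> (0 : R).
Proof.
elim: k e => [|k IH] e eke e0.
  rewrite count_exponent1 in eke.
  have h : (fun n : nat => n%:R `^ (1 - e) + n%:R `^ (- e) : R) @ \oo --> (0 : R).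
    rewrite -[X in _ --> X](addr0 0); apply: cvgD; apply: powR_natr_cvg0.
      by rewrite subr_lt0.
    by rewrite oppr_lt0.
  by apply: Phi1_cvg; exact: cvg_trans (@succ_over_powR e) h.
have h : (fun n : nat => (n%:R `^ (e + delta))^-1 * Phi_ n k.+1) @ \oo --> (0 : R).
  by apply: IH; [move: eke; rewrite [ex k.+2]count_exponentS; lra|rewrite addr_gt0].
have := tracks_powR (typical_Phi hp (ltn0Sn k)) (hit_negligible h) e0.
by rewrite mul0r.
Qed.

(** The intensity of the hits that feed degree [k] is summable as soon as the
    exponent of [k] is negative. *)
Lemma Phi_bounded k : ex k < 0 -> exists K : R, forall n, (0 < n)%N -> Phi_ n k <= K.
Proof.
case: k => [|[|k]].
- by rewrite /ex; have := gamma1; lra.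
- by rewrite count_exponent1 ltr10.
rewrite count_exponentS => ek.
have d0 := delta0.
(* A negative exponent with [e + delta] above both [ex k.+1] and [0]. *)
pose e := (Num.max (ex k.+1) 0 - delta) / 2.
have [m1 m2] : ex k.+1 <= Num.max (ex k.+1) 0 /\ 0 <= Num.max (ex k.+1) 0.
  by rewrite !le_max !lexx orbT.
have mx : Num.max (ex k.+1) 0 < delta by rewrite gt_max d0 andbT; lra.
have e0 : e < 0 by rewrite /e; lra.
have h : (fun n : nat => (n%:R `^ (e + delta))^-1 * Phi_ n k.+1) @ \oo --> (0 : R).
  by apply: Phi_negligible; rewrite /e; lra.
exact: (tracks_bounded (typical_Phi hp (ltn0Sn k)) (hit_negligible h) e0).
Qed.

Lemma Z_of_Phi k a : 0 < ex k.+1 ->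
  (fun n : nat => (n%:R `^ ex k.+1)^-1 * Phi_ n k.+1) @ \oo --> a ->
  (fun n : nat => (n%:R `^ ex k.+1)^-1 * Z_ n k.+1) @ \oo --> (a : R).
Proof.
move=> ek Pa; rewrite -[X in _ --> X]subr0.
under eq_fun do rewrite ZE mulrBr.
apply: cvgB => //; apply: Phi_negligible => //.
by rewrite count_exponentS ltrBlDr ltrDl.
Qed.

Lemma a_recurrence k : a_ gamma k.+2 = w k.+1 * a_ gamma k.+1 / ex k.+2.
Proof. by rewrite /a_ big_nat_recr//= mulrCA mulrA. Qed.

(** The limit for [k] gives the intensity of the hits of degree [k], and summing
    this intensity gives the limit for [k.+1]. *)
Lemma Phi_cvg k : 0 < ex k.+1 ->
  (fun n : nat => (n%:R `^ ex k.+1)^-1 * Phi_ n k.+1) @ \oo --> a_ gamma k.+1.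
Proof.
elim: k => [|k IH] ek.
  have h : (fun n : nat => n%:R `^ (1 - 1) + n%:R `^ (- 1) : R) @ \oo --> (1 : R).
    rewrite -[X in _ --> X]addr0.
    apply: cvgD; last by apply: powR_natr_cvg0; rewrite oppr_lt0.
    by rewrite subrr; under eq_fun do rewrite powRr0; exact: cvg_cst.
  rewrite count_exponent1 /a_ big_geq//; apply: Phi1_cvg.
  exact: cvg_trans (@succ_over_powR 1) h.
have ek' : 0 < ex k.+1.
  by rewrite (lt_trans ek)// [ex k.+2]count_exponentS ltrBlDr ltrDl.
have Zk := Z_of_Phi ek' (IH ek'); rewrite a_recurrence.
apply: (tracks_powR (typical_Phi hp (ltn0Sn k)) _ ek); apply: hit_cvg.
by rewrite [ex k.+2]count_exponentS subrK.
Qed.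

Lemma Z_cvg k : 0 < ex k.+1 ->
  (fun n : nat => (n%:R `^ ex k.+1)^-1 * Z_ n k.+1) @ \oo --> a_ gamma k.+1.
Proof. by move=> ek; apply: Z_of_Phi => //; exact: Phi_cvg. Qed.

Lemma Z_cvg_ln k : ex k.+2 = 0 ->
  (fun n : nat => (ln n%:R)^-1 * Z_ n k.+2) @ \oo --> b_ gamma k.+2.
Proof.
move=> ek; have ek1 : ex k.+1 = delta.
  by move: ek; rewrite [ex k.+2]count_exponentS => /eqP; rewrite subr_eq0 => /eqP.
have Zk : (fun n : nat => (n%:R `^ (ex k.+2 + delta))^-1 * Z_ n k.+1) @ \oo
    --> a_ gamma k.+1.
  by rewrite ek add0r -ek1; apply: Z_cvg; rewrite ek1.
have Pk := tracks_ln (typical_Phi hp (ltn0Sn k)) (hit_cvg Zk) ek.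
have [K HK] : exists K : R, forall n, (0 < n)%N -> Phi_ n k.+3 <= K.
  by apply: Phi_bounded; rewrite count_exponentS ek sub0r oppr_lt0.
have P0 : (fun n : nat => (ln n%:R)^-1 * Phi_ n k.+3) @ \oo --> (0 : R).
  have zero : (fun=> 0 : R) @ \oo --> (0 : R) by exact: cvg_cst.
  have lnV0 : (fun n : nat => (ln n%:R)^-1 : R) @ \oo --> (0 : R).
    have pos : \forall n \near \oo, 0 < ln n%:R :> R.
      near=> n; rewrite ln_gt0// ltr1n; near: n; exact: nbhs_infty_gt.
    by have [_ h] := gtr0_cvgV0 pos; apply: h; exact: ln_natr_cvgy.
  have up : (fun n : nat => (ln n%:R)^-1 * K : R) @ \oo --> (0 : R).
    by rewrite -(mul0r K); apply: cvgM => //; exact: cvg_cst.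
  apply: squeeze_cvgr zero up; near=> n.
  have n0 : (0 < n)%N by near: n; exact: nbhs_infty_gt.
  have l0 : 0 <= (ln n%:R)^-1 :> R by rewrite invr_ge0 ln_ge0// ler1n.
  by rewrite mulr_ge0//= ler_wpM2l// HK.
rewrite -[X in _ --> X]subr0.
by under eq_fun do rewrite ZE mulrBr; exact: cvgB.
Unshelve. all: by end_near. Qed.

End degree_counts.

(** * Measurable choice of the hub *)

(** Least choice makes the hub, the bound and the time measurable everywhere; the
    default value [0] only matters on a negligible event. *)
Definition first_such (q : nat -> Prop) : nat :=
  if pselect (exists n, `[<q n>]) is left h then ex_minn h else 0%N.

Lemma first_suchP (q : nat -> Prop) : (exists n, q n) -> q (first_such q).
Proof.
move=> [n qn]; rewrite /first_such; case: pselect => [h|nh]; last first.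
  by exfalso; apply: nh; exists n; exact/asboolP.
by case: ex_minnP => m /asboolP.
Qed.

Lemma first_suchE (q : nat -> Prop) m : first_such q = m <->
  (q m /\ forall k, (k < m)%N -> ~ q k) \/ (m = 0%N /\ forall k, ~ q k).
Proof.
rewrite /first_such; case: pselect => [h|nh]; last first.
  have nq k : ~ q k by move=> qk; apply: nh; exists k; exact/asboolP.
  by split=> [<-|[[/nq]|[]]//]; right.
case: ex_minnP => j /asboolP qj jmin; split=> [<-|].
  left; split=> // k kj qk; have /jmin : `[<q k>] by exact/asboolP.
  by rewrite leqNgt kj.
move=> [[qm mmin]|[_ nq]]; last by have := nq j qj.
apply/eqP; rewrite eqn_leq jmin/=; last exact/asboolP.
by rewrite leqNgt; apply/negP => /mmin.
Qed.

Section measurable_choice.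
Context d (T : measurableType d) (R : realType) (P : probability T R).

Lemma measurable_first_such (q : nat -> T -> Prop) :
  (forall n, measurable [set t | q n t]) ->
  forall m, measurable [set t | first_such (q^~ t) = m].
Proof.
move=> mq m; have mnq n : measurable [set t | ~ q n t] := measurableC (mq n).
rewrite (_ : [set t | _] = [set t | q m t /\ forall k, (k < m)%N -> ~ q k t] `|`
  [set t | m = 0%N /\ forall k, ~ q k t]).
  apply: measurableU; apply: measurable_conj => //.
  - apply: measurable_forall => [|k]; first exact: countableP.
    by apply: measurable_imply => //; exact: measurable_const.
  - exact: measurable_const.
  - apply: (@measurable_forall _ _ nat (fun k t => ~ q k t)) => [|k]; last exact: mnq.
    exact: countableP.
by apply/seteqP; split=> t /=; [move=> /first_suchE|move=> h; apply/first_suchE].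
Qed.

Lemma measurable_fun_nat (f : T -> nat) :
  (forall m, measurable [set t | f t = m]) -> measurable_fun [set: T] f.
Proof.
move=> mf _ Y _; rewrite setTI.
rewrite (_ : f @^-1` Y = [set t | exists m, Y m /\ f t = m]).
  apply: measurable_exists => [|m]; first exact: countableP.
  by apply: measurable_conj; [exact: measurable_const|exact: mf].
by apply/seteqP; split=> t /= => [Yt|[m [Ym ->]]//]; exists (f t).
Qed.

End measurable_choice.

Section hub_choice.
Context d (T : measurableType d) (R : realType) (P : probability T R).
Variables (w : nat -> R) (G : nat -> T -> graph).
Hypothesis hG : preferential_attachment P w G.

Definition hub (t : T) : nat :=
  first_such (fun v => forall N, exists n, (0 < n)%N /\ (N < deg (G n t) v)%N).

Definition others_bound (t : T) : nat :=
  first_such (fun C => forall n u, (0 < n)%N -> u <> hub t -> (deg (G n t) u <= C)%N).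

Definition hub_time (t : T) : nat :=
  first_such (fun m => forall n, (0 < n)%N -> (m <= n)%N ->
    (hub t < nvertices (G n t))%N /\ deg (G n t) (hub t) = Vmax (G n t)).

Let measurable_imply_gt0 n (p : T -> Prop) : ((0 < n)%N -> measurable [set t | p t]) ->
  measurable [set t | (0 < n)%N -> p t].
Proof.
move=> mp; have [n0|n0] := posnP n.
  by rewrite (_ : [set t | _] = setT)//; apply/seteqP; split=> t //= _; rewrite n0.
by apply: measurable_imply; [exact: measurable_const|exact: mp].
Qed.

Let measurable_hub v : measurable [set t | hub t = v].
Proof.
apply: measurable_first_such => {}v.
apply: measurable_forall => [|N]; first exact: countableP.
apply: measurable_exists => [|n]; first exact: countableP.
have [n0|n0] := posnP n; last first.
  apply: measurable_conj; first exact: measurable_const.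
  exact: (measurable_G hG (fun g => (N < deg g v)%N)).
by rewrite (_ : [set t | _] = set0)//; apply/seteqP; split=> t //= []; rewrite n0.
Qed.

Lemma measurable_fun_hub : measurable_fun [set: T] hub.
Proof. exact: measurable_fun_nat. Qed.

Lemma measurable_fun_others_bound : measurable_fun [set: T] others_bound.
Proof.
apply: measurable_fun_nat; apply: measurable_first_such => C.
apply: measurable_forall => [|n]; first exact: countableP.
apply: measurable_forall => [|u]; first exact: countableP.
apply: measurable_imply_gt0 => n0; apply: measurable_imply.
  rewrite (_ : [set t | _] = ~` [set t | hub t = u]); first exact: measurableC.
  by apply/seteqP; split=> t /= /nesym.
exact: (measurable_G hG (fun g => (deg g u <= C)%N)).
Qed.

Lemma measurable_fun_hub_time : measurable_fun [set: T] hub_time.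
Proof.
apply: measurable_fun_nat; apply: measurable_first_such => m.
apply: measurable_forall => [|n]; first exact: countableP.
apply: measurable_imply_gt0 => n0; apply: measurable_imply.
  exact: measurable_const.
rewrite (_ : [set t | _] = [set t | exists v, hub t = v /\
  ((v < nvertices (G n t))%N /\ deg (G n t) v = Vmax (G n t))]).
  apply: measurable_exists => [|v]; first exact: countableP.
  apply: measurable_conj => //.
  exact: (measurable_G hG (fun g => (v < nvertices g)%N /\ deg g v = Vmax g)).
by apply/seteqP; split=> t /= => [h|[v [-> h]]//]; exists (hub t).
Qed.

End hub_choice.

Lemma hub_typical d (T : measurableType d) (R : realType) (gamma : R)
    (G : nat -> T -> graph) t : 1 < gamma -> typical gamma (G ^~ t) ->
  (forall n u, (0 < n)%N -> u <> hub G t -> (deg (G n t) u <= others_bound G t)%N) /\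
  (forall n, (0 < n)%N -> (hub_time G t <= n)%N ->
    (hub G t < nvertices (G n t))%N /\ deg (G n t) (hub G t) = Vmax (G n t)).
Proof.
move=> gamma1 ht.
have hv : unbounded_deg (G ^~ t) (hub G t).
  have h : forall N, exists n, (0 < n)%N /\ (N < deg (G n t) (hub G t))%N.
    apply: (first_suchP (q := fun v => forall N, exists n,
      (0 < n)%N /\ (N < deg (G n t) v)%N)).
    have [v hv] := hub_exists gamma1 ht; exists v => N.
    by have [n n0 Nn] := hv N; exists n.
  by move=> N; have [n [n0 Nn]] := h N; exists n.
split.
  apply: (first_suchP (q := fun C => forall n u, (0 < n)%N -> u <> hub G t ->
    (deg (G n t) u <= C)%N)).
  by have [C HC] := hub_others gamma1 ht hv; exists C => n u n0 uv; exact: HC.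
apply: (first_suchP (q := fun m => forall n, (0 < n)%N -> (m <= n)%N ->
    (hub G t < nvertices (G n t))%N /\ deg (G n t) (hub G t) = Vmax (G n t))).
exact: (hub_dominates gamma1 ht hv).
Qed.

Theorem theorem1 (R : realType) (d : measure_display) (T : measurableType d)
    (P : probability T R) (gamma : R) (hgamma : 1 < gamma)
    (G : nat -> T -> graph)
    (hG : preferential_attachment P (weight gamma) G) :
  ((forall k : nat, (1 <= k)%N -> k%:R < gamma / (gamma - 1) ->
      {ae P, forall t : T,
        (fun n : nat => (n%:R `^ (k%:R - (k%:R - 1) * gamma))^-1 *
                        (Zdeg k (G n t))%:R) @ \oo --> a_ gamma k}) /\
   (forall k : nat, (2 <= k)%N -> k%:R = gamma / (gamma - 1) ->
      {ae P, forall t : T,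
        (fun n : nat => (ln (n%:R : R))^-1 * (Zdeg k (G n t))%:R) @ \oo
          --> b_ gamma k}) /\
   (forall k : nat, gamma / (gamma - 1) < k%:R ->
      {ae P, forall t : T,
        cvgn (fun n : nat => (((Phi k (G n t))%:R : R)%:E)) /\
        (limn (fun n : nat => (((Phi k (G n t))%:R : R)%:E)) < +oo)%E}))
  /\
  (exists n0 v C : T -> nat,
     [/\ measurable_fun [set: T] n0,
         measurable_fun [set: T] v,
         measurable_fun [set: T] C,
         {ae P, forall t : T, forall n : nat, (1 <= n)%N -> (n0 t <= n)%N ->
            (v t < nvertices (G n t))%N /\ deg (G n t) (v t) = Vmax (G n t)} &
         {ae P, forall t : T, forall n u : nat, (1 <= n)%N ->
            (u < nvertices (G n t))%N -> u <> v t ->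
            (deg (G n t) u <= C t)%N}]) /\
  {ae P, forall t : T,
     (fun n : nat => (n%:R : R)^-1 * (Vmax (G n t))%:R) @ \oo --> (1 : R)}.
Proof.
have typ := typical_ae hgamma hG.
have g0 : 0 < gamma - 1 by rewrite subr_gt0.
have exE k : count_exponent gamma k = gamma - k%:R * (gamma - 1).
  by rewrite /count_exponent; ring.
split; [split; [|split]|split].
- case=> // k _; rewrite ltr_pdivlMr// => kg; apply: filterS typ => t ht.
  by apply: (Z_cvg hgamma ht); rewrite exE subr_gt0.
- case=> // -[|k] // _ kE; apply: filterS typ => t ht.
  by apply: (Z_cvg_ln hgamma ht); rewrite exE kE divfK ?subrr// gt_eqF.
- move=> k; rewrite ltr_pdivrMr// => kg; apply: filterS typ => t ht.
  have [K HK] : exists K : R, forall n, (0 < n)%N -> (Phi k (G n t))%:R <= K.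
    by apply: (Phi_bounded hgamma ht); rewrite exE subr_lt0.
  have [m m0 Hm] := Phi_stable hgamma ht HK.
  have cv : (fun n : nat => ((Phi k (G n t))%:R : R)%:E) @ \oo -->
      ((Phi k (G m t))%:R : R)%:E.
    by apply: cvg_near_cst; exists m => // n mn; rewrite Hm.
  split; first by apply/cvg_ex; eexists; exact: cv.
  by rewrite (cvg_lim _ cv)// ltry.
- exists (hub_time G), (hub G), (others_bound G); split.
  + exact: measurable_fun_hub_time hG.
  + exact: measurable_fun_hub hG.
  + exact: measurable_fun_others_bound hG.
  + by apply: filterS typ => t /(hub_typical hgamma)[].
  + apply: filterS typ => t /(hub_typical hgamma)[H _] n u n0 _; exact: H.
- apply: filterS typ => t ht; exact: Vmax_equiv hgamma ht.
Qed.
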